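(* For every real $r>\frac{176}{51}$ there is a constant $C_r$ such that the following holds. Let $p$ be a prime such that $-1$ is not a square in $F=\mathbb{F}_p$, let $e$ be a nontrivial additive character of $F$, and let $P_3=\{(\underline{x},\underline{x}\cdot\underline{x}):\underline{x}\in F^2\}\subset F^3$. Then for every $f:P_3\to\mathbb{C}$, $$\|(f\,d\sigma)^\vee\|_{L^r(F^3)}\le C_r\,\|f\|_{L^2(P_3,d\sigma)}.$$ (That is, $R^*(2\to r)\lesssim_r 1$ for every $r>\frac{176}{51}$; the constant $C_r$ does not depend on $p$.)
   Context: Here $\underline{x}\cdot\underline{y}=x_1y_1+x_2y_2$ is the standard dot product on $F^2$ (and similarly on $F^3$). The paraboloid $P_3$, which has $p^2$ points, carries the normalized counting measure $d\sigma$ assigning mass $p^{-2}$ to each point, so $\|f\|_{L^2(P_3,d\sigma)}^2=p^{-2}\sum_{\xi\in P_3}|f(\xi)|^2$. The Fourier extension operator is $$(f\,d\sigma)^\vee(x)=p^{-2}\sum_{\xi\in P_3}f(\xi)\,e(x\cdot\xi),\qquad x\in F^3.$$ The space $F^3$ carries counting measure, so $\|g\|_{L^r(F^3)}^r=\sum_{x\in F^3}|g(x)|^r$. $R^*(2\to r)$ denotes the best constant in the displayed inequality. *)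

(* Defs.v *)
From mathcomp Require Import all_boot all_order all_algebra.
From mathcomp Require Import complex.
From mathcomp Require Import reals exp.

Set Implicit Arguments.
Unset Strict Implicit.
Unset Printing Implicit Defensive.

Import Order.TTheory GRing.Theory Num.Theory.

Local Open Scope ring_scope.
Local Open Scope complex_scope.

Definition dot (K : pzSemiRingType) (n : nat) (x y : 'rV[K]_n) : K :=
  \sum_(i < n) x ord0 i * y ord0 i.

Definition additive_character (R : rcfType) (G : zmodType) (e : G -> R[i]) :
    Prop :=
  e 0 = 1 /\ forall x y : G, e (x + y) = e x * e y.

Definition nontrivial (R : rcfType) (G : zmodType) (e : G -> R[i]) : Prop :=
  exists x : G, e x <> 1.

Definition paraboloid3 (p : nat) : {set 'rV['F_p]_3} :=
  [set row_mx x (const_mx (dot x x) : 'rV_1) | x : 'rV['F_p]_2].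

Notation P3 p := {xi : 'rV['F_p]_3 | xi \in paraboloid3 p}.

Definition extension (R : rcfType) (p : nat) (e : 'F_p -> R[i])
    (f : P3 p -> R[i]) (x : 'rV['F_p]_3) : R[i] :=
  p%:R ^- 2 * \sum_(xi : P3 p) f xi * e (dot x (val xi)).

(* [Normc.normc] is the complex modulus with values in [R]; the norm [`|z|] of
   [z : R[i]] lives in [R[i]]. *)
Definition norm_L2_P3 (R : rcfType) (p : nat) (f : P3 p -> R[i]) : R :=
  Num.sqrt (p%:R ^- 2 * \sum_(xi : P3 p) Normc.normc (f xi) ^+ 2).

Definition norm_Lr_F3 (R : realType) (p : nat) (r : R)
    (g : 'rV['F_p]_3 -> R[i]) : R :=
  (\sum_(x : 'rV['F_p]_3) Normc.normc (g x) `^ r) `^ r^-1.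

(* Main.v *)
(** Write E for the extension operator, p for the size of the field, and let
    G be the set where [E f] exceeds l, for f of norm at most 1; G_t is its
    slice at the last coordinate t.  Three observations bound X = |G|.

    - On a line of direction w in the slice t, the mass of [|E f|^2] is governed
      by the one-dimensional parabola, whose [L^4] extension estimate is exact.
      Hence, summed over t, the number of pairs of points of G_t lying on a
      common line of a fixed direction is O(l^-4).
    - By duality [(l X)^2] is at most X plus an interaction between the
      slices; completing squares, [|E|^2] of a function on G_a, restricted to
      G_t, is a sum over frequencies w of an autocorrelation of G_a at
      [2 (t - a) w] against the Fourier transform of G_t.  By Cauchy-Schwarz
      along each direction the first factor counts trapezoids (pairs of parallel
      segments in two slices), and the second one is bounded by the first
      observation.
    - For a single slice the phases can be kept, and then the first factor counts
      corners (pairs of orthogonal segments with a common end), which are at most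
      [N^3 / p + p^(1/2) N^2] for a set of N points, since -1 is not a square.

    The resulting inequalities combine to [l^24 X^7 = O(1)], that is to the weak
    type estimate at exponent 24/7, and 24/7 < 176/51. *)
Require Import Defs.
From mathcomp Require Import all_boot all_order all_algebra.
From mathcomp Require Import complex.
From mathcomp Require Import reals exp.
From mathcomp Require Import ring lra.

Set Implicit Arguments.
Unset Strict Implicit.
Unset Printing Implicit Defensive.

Import Order.TTheory GRing.Theory Num.Theory.

Local Open Scope ring_scope.
Local Open Scope complex_scope.

(** * Complex moduli, Cauchy-Schwarz, characters *)

Local Notation nrm := Normc.normc.

Section ComplexModulus.
Variable R : rcfType.
Implicit Types (z t : R[i]).

Lemma nrmE z : `|z| = (nrm z)%:C. Proof. by []. Qed.

Lemma nrm_ge0 z : 0 <= nrm z. Proof. by case: z => a b; apply: sqrtr_ge0. Qed.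

Lemma nrm_sqr z : (nrm z ^+ 2)%:C = z * conjc z.
Proof. by rewrite rmorphXn /= -sqr_normc. Qed.

Lemma nrm_sqr_eq z (a : R) : z * conjc z = a%:C -> nrm z ^+ 2 = a.
Proof. by move=> h; apply: complexI; rewrite nrm_sqr. Qed.

Lemma nrm_conj z : nrm (conjc z) = nrm z.
Proof. by apply: complexI; rewrite -!nrmE normcJ. Qed.

Lemma nrm_real (a : R) : 0 <= a -> nrm a%:C = a.
Proof. by move=> a0; apply: complexI; rewrite -nrmE ger0_norm ?ler0c. Qed.

Lemma nrm_nat n : nrm (n%:R : R[i]) = n%:R.
Proof. by apply: complexI; rewrite -nrmE normr_nat rmorph_nat. Qed.

Lemma nrm_sum (I : Type) (s : seq I) (P : pred I) (f : I -> R[i]) :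
  nrm (\sum_(i <- s | P i) f i) <= \sum_(i <- s | P i) nrm (f i).
Proof.
rewrite -lecR rmorph_sum /=.
by under [leRHS]eq_bigr => i _ do rewrite -nrmE; rewrite -nrmE; apply: ler_norm_sum.
Qed.

End ComplexModulus.

Section CauchySchwarz.
Variable R : rcfType.
Variables (I : Type) (s : seq I) (P : pred I).

(** The quadratic form [key] in [x], [y] is a sum of squares, hence nonnegative; its values at two
    well-chosen points give the claim. *)
Lemma cauchy_schwarz_sqr (f g : I -> R) :
  (\sum_(i <- s | P i) f i * g i) ^+ 2 <=
  (\sum_(i <- s | P i) f i ^+ 2) * (\sum_(i <- s | P i) g i ^+ 2).
Proof.
set A := \sum_(i <- s | P i) f i ^+ 2; set B := \sum_(i <- s | P i) g i ^+ 2.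
set S := \sum_(i <- s | P i) _.
have B0 : 0 <= B by apply: sumr_ge0 => i _; apply: sqr_ge0.
have A0 : 0 <= A by apply: sumr_ge0 => i _; apply: sqr_ge0.
have key x y : 0 <= x ^+ 2 * A - 2 * x * y * S + y ^+ 2 * B.
  have -> : x ^+ 2 * A - 2 * x * y * S + y ^+ 2 * B =
      \sum_(i <- s | P i) (x * f i - y * g i) ^+ 2.
    rewrite /A /B /S !mulr_sumr -sumrB -big_split /=.
    by apply: eq_bigr => i _; ring.
  by apply: sumr_ge0 => i _; apply: sqr_ge0.
have [B00|Bn] := eqVneq B 0.
  (* If [B = 0] the form is linear in [y], so [S] must vanish: this [y] would give it the value
     [A - 2 (A + 1) < 0]. *)
  have k1 := key 1 (S^-1 * (A + 1)).
  have [->|Sn] := eqVneq S 0; first by rewrite expr0n /= mulr_ge0.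
  suff : False by [].
  move: k1; rewrite B00 mulr0 addr0 expr1n mul1r mulr1 -mulrA.
  have -> : S^-1 * (A + 1) * S = A + 1 by field.
  by move: A0; lra.
have Bp : 0 < B by rewrite lt_def Bn.
(* At [(B, S)] the form equals [B (A B - S^2)]. *)
have k := key B S.
rewrite -(ler_pM2l Bp); nra.
Qed.

Lemma cauchy_schwarz (f g : I -> R) :
  \sum_(i <- s | P i) f i * g i <=
  Num.sqrt (\sum_(i <- s | P i) f i ^+ 2) *
  Num.sqrt (\sum_(i <- s | P i) g i ^+ 2).
Proof.
apply: le_trans (ler_norm _) _.
rewrite -sqrtrM; last by apply: sumr_ge0 => i _; apply: sqr_ge0.
by rewrite -sqrtr_sqr ler_wsqrtr // cauchy_schwarz_sqr.
Qed.

Lemma cauchy_schwarz_nrm (f g : I -> R[i]) :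
  nrm (\sum_(i <- s | P i) f i * g i) ^+ 2 <=
  (\sum_(i <- s | P i) nrm (f i) ^+ 2) * (\sum_(i <- s | P i) nrm (g i) ^+ 2).
Proof.
apply: le_trans _ (cauchy_schwarz_sqr (fun i => nrm (f i)) (fun i => nrm (g i))).
rewrite ler_sqr ?nnegrE ?nrm_ge0 //; last first.
  by apply: sumr_ge0 => i _; rewrite mulr_ge0 ?nrm_ge0.
apply: le_trans (nrm_sum _ _ _) _.
by under eq_bigr => i _ do rewrite Normc.normcM.
Qed.

Lemma sum_sqr_le_card (f : I -> R) :
  (\sum_(i <- s | P i) f i) ^+ 2 <=
  (\sum_(i <- s | P i) 1) * \sum_(i <- s | P i) f i ^+ 2.
Proof.
have := cauchy_schwarz_sqr (fun=> 1) f.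
under eq_bigr do rewrite mul1r.
by under [X in _ <= X * _ -> _]eq_bigr do rewrite expr1n.
Qed.

End CauchySchwarz.

(** * Additive characters of a finite field and orthogonality *)

Section Characters.
Variables (R : rcfType) (F : finFieldType) (e : F -> R[i]).
Hypothesis e0 : e 0 = 1.
Hypothesis eD : forall x y, e (x + y) = e x * e y.
Hypothesis e_nontriv : exists x, e x <> 1.

Local Notation p := (#|F|%:R : R).
Local Notation V := (F * F)%type.

(** Translating by [x] permutes the factors of the product [m] of all moduli and multiplies it by
    [nrm (e x) ^+ #|F|], which is therefore 1. *)
Lemma char_nrm x : nrm (e x) = 1.
Proof.
have en0 y : e y != 0.
  apply/eqP => ey; have := eD y (- y); rewrite ey mul0r subrr e0 => /eqP.
  by rewrite oner_eq0.
have nn0 y : nrm (e y) != 0 by apply: contra (en0 y) => /eqP/Normc.eq0_normc ->.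
pose m := \prod_y nrm (e y).
have m0 : m != 0 by apply/prodf_neq0 => y _.
have : m = m * nrm (e x) ^+ #|F|.
  rewrite {1}/m (reindex_inj (addIr x)) /=.
  under eq_bigr => y _ do rewrite eD Normc.normcM.
  by rewrite big_split /= prodr_const.
rewrite -{1}[m]mulr1 => /(mulfI m0)/esym/eqP.
by rewrite pexpr_eq1 ?nrm_ge0 //; [move/eqP | apply/card_gt0P; exists 0].
Qed.

Lemma charN x : e (- x) = conjc (e x).
Proof.
have en0 : e x != 0.
  by apply/eqP => h; move: (char_nrm x); rewrite h Normc.normc0 => /esym/eqP; rewrite oner_eq0.
apply: (mulfI en0); rewrite -eD subrr e0 -nrm_sqr char_nrm.
by rewrite expr1n.
Qed.

Lemma char_conj x y : e x * conjc (e y) = e (x - y).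
Proof. by rewrite -charN -eD. Qed.

(** For [a != 0], the shift of [t] by [x / a] multiplies the sum by [e x], and [x] can be chosen
    with [e x != 1]. *)
Lemma sum_char a : \sum_t e (t * a) = ((a == 0)%:R * p)%:C.
Proof.
have [->|an] /= := eqVneq a 0.
  under eq_bigr => t _ do rewrite mulr0 e0.
  by rewrite sumr_const mul1r rmorph_nat.
rewrite mul0r; case: e_nontriv => x /eqP ex.
have : \sum_t e (t * a) = e x * \sum_t e (t * a).
  rewrite {1}(reindex_inj (addrI (x / a))) /= mulr_sumr.
  by apply: eq_bigr => t _; rewrite mulrDl eD; congr (e _ * _); field.
move/eqP; rewrite -subr_eq0 -{1}[\sum_t _]mul1r -mulrBl mulf_eq0 subr_eq0 eq_sym.
by rewrite (negbTE ex) => /eqP.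
Qed.

(** Common source of the Parseval identities: [K] tells which pairs of phases fail to be orthogonal,
    and it may be coarser than equality. *)
Lemma gram_sum (T U : finType) (h : T -> R[i]) (phi : T -> U -> R[i])
    (K : T -> T -> bool) (c : R) :
    (forall x y, \sum_u phi x u * conjc (phi y u) = ((K x y)%:R * c)%:C) ->
  (\sum_u nrm (\sum_x h x * phi x u) ^+ 2)%:C =
  c%:C * \sum_x \sum_(y | K x y) h x * conjc (h y).
Proof.
move=> hphi; rewrite rmorph_sum /=.
under eq_bigr => u _ do rewrite nrm_sqr rmorph_sum big_distrlr /=.
rewrite exchange_big /= mulr_sumr; apply: eq_bigr => x _.
rewrite exchange_big /= mulr_sumr big_mkcond [RHS]big_mkcond /=.
apply: eq_bigr => y _.
transitivity (h x * conjc (h y) * \sum_u phi x u * conjc (phi y u)).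
  by rewrite mulr_sumr; apply: eq_bigr => u _; rewrite rmorphM /=; ring.
rewrite hphi; case: (K x y); first by rewrite mul1r mulrC.
by rewrite mul0r mulr0.
Qed.

(** The phases only see [q x], so Parseval in the frequency [t] returns the masses of the fibres of
    [q]. With [q] a linear form these are masses of lines. *)
Lemma fiber_parseval (T : finType) (h : T -> R[i]) (q : T -> F) :
  \sum_t nrm (\sum_x h x * e (t * q x)) ^+ 2 =
  p * \sum_s nrm (\sum_(x | q x == s) h x) ^+ 2.
Proof.
apply: complexI.
rewrite (@gram_sum _ _ h (fun x t => e (t * q x)) (fun x y => q x == q y) p); last first.
  move=> x y; under eq_bigr => t _ do rewrite char_conj -mulrBr.
  by rewrite sum_char subr_eq0.
rewrite rmorphM rmorph_sum /=; congr (_ * _).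
under [RHS]eq_bigr => s _ do rewrite nrm_sqr rmorph_sum big_distrlr /=.
rewrite (partition_big q predT) //=; apply: eq_bigr => s _.
apply: eq_bigr => x /eqP <-; apply: eq_bigl => y; exact: eq_sym.
Qed.

End Characters.

(** * The extension operator on the plane *)

Section Plane.
Variable F : fieldType.
Local Notation V := (F * F)%type.
Implicit Types (x y z w : V) (k l : F).

Definition dot2 x y : F := x.1 * y.1 + x.2 * y.2.
Definition scale2 k x : V := (k * x.1, k * x.2).

Lemma dot2C x y : dot2 x y = dot2 y x.
Proof. by rewrite /dot2; ring. Qed.

Lemma dot2Dl x y z : dot2 (x + y) z = dot2 x z + dot2 y z.
Proof. by case: x y z => [? ?] [? ?] [? ?]; rewrite /dot2 /=; ring. Qed.

Lemma dot2Nl x z : dot2 (- x) z = - dot2 x z.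
Proof. by case: x z => [? ?] [? ?]; rewrite /dot2 /=; ring. Qed.

Lemma dot2Bl x y z : dot2 (x - y) z = dot2 x z - dot2 y z.
Proof. by rewrite dot2Dl dot2Nl. Qed.

Lemma dot2Zl k x z : dot2 (scale2 k x) z = k * dot2 x z.
Proof. by rewrite /dot2 /=; ring. Qed.

Lemma dot2Dr x y z : dot2 z (x + y) = dot2 z x + dot2 z y.
Proof. by rewrite !(dot2C z) dot2Dl. Qed.

Lemma dot2Nr x z : dot2 z (- x) = - dot2 z x.
Proof. by rewrite !(dot2C z) dot2Nl. Qed.

Lemma dot2Zr k x z : dot2 z (scale2 k x) = k * dot2 z x.
Proof. by rewrite !(dot2C z) dot2Zl. Qed.

Definition dot2E := (dot2Dl, dot2Dr, dot2Nl, dot2Nr, dot2Zl, dot2Zr).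

Lemma dot20l x : dot2 0 x = 0.
Proof. by rewrite /dot2 !mul0r addr0. Qed.

Lemma scale2A k l x : scale2 k (scale2 l x) = scale2 (k * l) x.
Proof. by rewrite /scale2 /= !mulrA. Qed.

Lemma scale21 x : scale2 1 x = x.
Proof. by case: x => a b; rewrite /scale2 !mul1r. Qed.

Lemma scale20 x : scale2 0 x = 0.
Proof. by rewrite /scale2 !mul0r. Qed.

Lemma scale2_eq0 k x : (scale2 k x == 0) = (k == 0) || (x == 0).
Proof.
case: x => a b; rewrite /scale2 /= -!pair_eqE /= /pair_eq /= !mulf_eq0.
by case: (k == 0).
Qed.

Lemma scale2_inj k : k != 0 -> injective (scale2 k).
Proof.
by move=> k0 x y h; rewrite -(scale21 x) -(scale21 y) -(mulVf k0) -!scale2A h.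
Qed.

Hypothesis m1_nonsquare : forall x : F, x ^+ 2 != -1.

(** The plane has no isotropic vectors: a nonzero one with [b != 0] would give [(a / b)^2 = -1]. *)
Lemma dot2_eq0 x : (dot2 x x == 0) = (x == 0).
Proof.
apply/eqP/eqP => [|->]; last exact: dot20l.
case: x => a b; rewrite /dot2 /= => h.
have [b0|b0] := eqVneq b 0.
  move: h; rewrite b0 mulr0 addr0 => /eqP; rewrite mulf_eq0 orbb => /eqP -> //.
have := m1_nonsquare (a / b); rewrite expr_div_n.
have -> : a ^+ 2 = - b ^+ 2 by apply/eqP; rewrite -subr_eq0 opprK !expr2 h.
by rewrite mulNr divff ?eqxx // expf_neq0.
Qed.

(** In characteristic 2 the square of 1 is -1. *)
Lemma two_neq0 : 2 != 0 :> F.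
Proof.
have := m1_nonsquare 1; apply: contra => /eqP h.
by rewrite expr1n -subr_eq0 opprK -h -[2]/(1 + 1).
Qed.

End Plane.

Lemma sum_cond_le (R : numDomainType) (T : finType) (P : pred T) (a : R) :
  (forall x y, P x -> P y -> x = y) -> 0 <= a -> \sum_(x | P x) a <= a.
Proof.
move=> hP a0; rewrite sumr_const.
suff : (#|P| <= 1)%N by case: #|_| => [|[|]].
by apply/card_le1_eqP => x y hx hy; apply: hP.
Qed.

(** The autocorrelation of the indicator function of [S]. *)
Definition overlap (R : pzSemiRingType) (F : finFieldType) (S : {set F * F})
    (d : F * F) : R :=
  \sum_(y : F * F) ((y \in S) && (y + d \in S))%:R.

Section Extension.
Variables (R : rcfType) (F : finFieldType) (e : F -> R[i]).
Hypothesis e0 : e 0 = 1.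
Hypothesis eD : forall x y, e (x + y) = e x * e y.
Hypothesis e_nontriv : exists x, e x <> 1.
Hypothesis m1_nonsquare : forall x : F, x ^+ 2 != -1.

Local Notation p := (#|F|%:R : R).
Local Notation V := (F * F)%type.

Lemma card_field_gt0 : 0 < p.
Proof. by rewrite ltr0n; apply/card_gt0P; exists 0. Qed.

Lemma sum_char2 (a : V) :
  \sum_(x : V) e (dot2 a x) = ((a == 0)%:R * p ^+ 2)%:C.
Proof.
rewrite -(pair_big predT predT (fun u v => e (a.1 * u + a.2 * v))) /=.
under eq_bigr => u _.
  under eq_bigr => v _ do rewrite eD [a.2 * v]mulrC.
  rewrite -mulr_sumr (sum_char e0 eD e_nontriv) [a.1 * u]mulrC.
over.
rewrite -mulr_suml (sum_char e0 eD e_nontriv) -rmorphM /=.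
case: a => a b; rewrite -pair_eqE /= /pair_eq /=; congr (_ %:C).
by case: (a == 0); case: (b == 0); rewrite /= ?mul0r ?mulr0 ?mul1r.
Qed.

Lemma parseval2 (h : V -> R[i]) :
  \sum_(x : V) nrm (\sum_(y : V) h y * e (dot2 y x)) ^+ 2 =
  p ^+ 2 * \sum_(y : V) nrm (h y) ^+ 2.
Proof.
apply: complexI.
rewrite (@gram_sum _ _ _ h (fun y x => e (dot2 y x)) (fun x y => x == y) (p ^+ 2)).
  rewrite [RHS]rmorphM rmorph_sum; congr (_ * _); apply: eq_bigr => y _ /=.
  by under eq_bigl do rewrite eq_sym; rewrite big_pred1_eq -nrm_sqr.
move=> x y; under eq_bigr => u _ do rewrite (char_conj e0 eD) -dot2Bl.
by rewrite sum_char2 subr_eq0.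
Qed.

(** The extension operator without its factor [p^-2], with the paraboloid parametrized by the plane
    and the last coordinate [t] singled out as a time. *)
Definition ext2 (f : V -> R[i]) (x : V) (t : F) : R[i] :=
  \sum_(xi : V) f xi * e (dot2 x xi + t * dot2 xi xi).

(** Each slice is the Fourier transform of [f] times a unimodular phase. *)
Lemma ext2_slice (f : V -> R[i]) t :
  \sum_x nrm (ext2 f x t) ^+ 2 = p ^+ 2 * \sum_xi nrm (f xi) ^+ 2.
Proof.
transitivity (\sum_(x : V) nrm (\sum_(y : V) (f y * e (t * dot2 y y)) * e (dot2 y x)) ^+ 2).
  apply: eq_bigr => x _; congr (nrm _ ^+ 2); apply: eq_bigr => y _.
  by rewrite dot2C eD; ring.
rewrite parseval2; congr (_ * _); apply: eq_bigr => y _.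
by rewrite Normc.normcM (char_nrm e0 eD) mulr1.
Qed.

(** In the expanded square, the sum over [x] annihilates every pair [(xi, eta)] except those with
    [eta = xi + v]. *)
Lemma ext2_autocorrelation (f : V -> R[i]) t (v : V) :
  \sum_x (nrm (ext2 f x t) ^+ 2)%:C * e (dot2 x v) =
  (p ^+ 2)%:C * \sum_xi f xi * conjc (f (xi + v)) *
                 e (t * (dot2 xi xi - dot2 (xi + v) (xi + v))).
Proof.
under eq_bigr => x _.
  rewrite nrm_sqr rmorph_sum big_distrlr /= mulr_suml.
  under eq_bigr => xi _ do rewrite mulr_suml.
over.
rewrite exchange_big mulr_sumr /=; apply: eq_bigr => xi _.
rewrite exchange_big /=.
transitivity (\sum_(eta : V) f xi * conjc (f eta) * e (t * (dot2 xi xi - dot2 eta eta)) *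
   \sum_(x : V) e (dot2 (xi - eta + v) x)).
  apply: eq_bigr => eta _; rewrite mulr_sumr; apply: eq_bigr => x _.
  rewrite rmorphM /=.
  transitivity (f xi * conjc (f eta) * (e (dot2 x xi + t * dot2 xi xi) *
      conjc (e (dot2 x eta + t * dot2 eta eta)) * e (dot2 x v))); first by ring.
  rewrite (char_conj e0 eD) -eD -[RHS]mulrA -eD; congr (_ * e _).
  by rewrite !dot2E ![dot2 _ x]dot2C; ring.
have xi0 : xi - (xi + v) + v = 0 by rewrite opprD addrA subrr sub0r addNr.
rewrite (bigD1 (xi + v)) //= sum_char2 xi0 eqxx mul1r.
rewrite big1 ?addr0; first by rewrite mulrC.
move=> eta ne; rewrite sum_char2.
have -> : (xi - eta + v == 0) = false.
  by apply/negbTE; apply: contra ne; rewrite addrAC subr_eq0 eq_sym.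
by rewrite mul0r mulr0.
Qed.

(* The [L^4] estimate for the one-dimensional parabola, applied to the mass of
   [|E f|^2] on the lines with normal [w]; since [dot2 w w != 0], the condition
   that two phases [dot2 xi xi - dot2 (xi + k w) (xi + k w)] agree determines
   [k]. *)
Lemma line_mass_l2 (f : V -> R[i]) (w : V) : w != 0 ->
  \sum_t \sum_k nrm (\sum_x (nrm (ext2 f x t) ^+ 2)%:C * e (dot2 x (scale2 k w))) ^+ 2
  <= 2 * p ^+ 5 * (\sum_xi nrm (f xi) ^+ 2) ^+ 2.
Proof.
move=> w0; set M := \sum_xi nrm (f xi) ^+ 2; pose a xi := nrm (f xi) ^+ 2.
have a0 xi : 0 <= a xi by apply: sqr_ge0.
pose q k xi := dot2 xi xi - dot2 (xi + scale2 k w) (xi + scale2 k w).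
(* For fixed [k], Parseval in [t] leaves the fibres of the phase [q k], and Cauchy-Schwarz on each
   fibre separates [f xi] from its translate. *)
have step k : \sum_t nrm (\sum_x (nrm (ext2 f x t) ^+ 2)%:C * e (dot2 x (scale2 k w))) ^+ 2
   <= p ^+ 5 * \sum_xi \sum_(eta | q k eta == q k xi) a xi * a (eta + scale2 k w).
  under eq_bigr => t _ do
    rewrite ext2_autocorrelation Normc.normcM nrm_real ?exprn_ge0 ?ler0n // exprMn -exprM.
  rewrite -mulr_sumr (fiber_parseval e0 eD e_nontriv) mulrA -exprSr.
  rewrite ler_wpM2l ?exprn_ge0 ?ler0n //.
  rewrite [leRHS](partition_big (q k) predT) //=; apply: ler_sum => s _.
  apply: le_trans (cauchy_schwarz_nrm _ _ _ _) _.
  rewrite big_distrlr /= le_eqVlt; apply/orP; left; apply/eqP.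
  apply: eq_bigr => xi /eqP hs; apply: eq_big => eta; first by rewrite -hs.
  by rewrite nrm_conj.
rewrite exchange_big /=; apply: le_trans (ler_sum _ (fun k _ => step k)) _.
rewrite -mulr_sumr -mulrA mulrCA ler_wpM2l ?exprn_ge0 ?ler0n //.
(* The factor 2: one copy of [M^2] pays for [k = 0], where [q] vanishes identically, the other for
   all [k != 0] together. *)
rewrite (bigD1 0) //= mulr2n mulrDl !mul1r; apply: lerD.
  rewrite expr2 big_distrlr /=; apply: ler_sum => xi _.
  rewrite big_mkcond; apply: ler_sum => eta _.
  by case: ifP => _; rewrite ?scale20 ?addr0 // mulr_ge0 ?sqr_ge0.
have swap k : \sum_xi \sum_(eta | q k eta == q k xi) a xi * a (eta + scale2 k w) =
   \sum_(xi : V) \sum_(eta : V) (if q k (eta - scale2 k w) == q k xi then a xi * a eta else 0).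
  apply: eq_bigr => xi _; rewrite [RHS](reindex_inj (addIr (scale2 k w))) /=.
  by rewrite big_mkcond; apply: eq_bigr => eta _; rewrite addrK.
under eq_bigr => k _ do rewrite swap.
rewrite exchange_big /= expr2 big_distrlr /=; apply: ler_sum => xi _.
rewrite exchange_big /=; apply: ler_sum => eta _.
rewrite -big_mkcondr /=; apply: sum_cond_le; last by rewrite mulr_ge0.
have solve k : k != 0 -> q k (eta - scale2 k w) == q k xi ->
    k * dot2 w w = dot2 (eta - xi) w.
  move=> k0; rewrite -subr_eq0.
  have -> : q k (eta - scale2 k w) - q k xi =
      2 * k * (k * dot2 w w - dot2 (eta - xi) w).
    by rewrite /q !dot2E (dot2C w eta) (dot2C w xi); ring.
  by rewrite !mulf_eq0 (negbTE (two_neq0 m1_nonsquare)) (negbTE k0) /= subr_eq0 => /eqP.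
move=> k l /andP[k0 /(solve _ k0) hk] /andP[l0 /(solve _ l0) hl].
have ww : dot2 w w != 0 by rewrite dot2_eq0.
by apply: (mulIf ww); rewrite hk hl.
Qed.

End Extension.

(** * Duality and autocorrelations *)

Section Duality.
Variables (R : rcfType) (F : finFieldType) (e : F -> R[i]).
Hypothesis e0 : e 0 = 1.
Hypothesis eD : forall x y, e (x + y) = e x * e y.
Hypothesis e_nontriv : exists x, e x <> 1.
Hypothesis m1_nonsquare : forall x : F, x ^+ 2 != -1.

Local Notation p := (#|F|%:R : R).
Local Notation V := (F * F)%type.

Variable G : F -> {set V}.
Local Notation N a := (#|G a|%:R : R).

Definition slice_hat (t : F) (w : V) : R := nrm (\sum_(x in G t) e (dot2 x w)).

Lemma slice_hat0 t : slice_hat t 0 = N t.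
Proof.
rewrite /slice_hat; under eq_bigr => x _ do rewrite dot2C dot20l e0.
by rewrite sumr_const nrm_nat.
Qed.

Lemma slice_hat_l2 t : \sum_w slice_hat t w ^+ 2 = p ^+ 2 * N t.
Proof.
transitivity (\sum_(w : V) nrm (\sum_(x : V) (x \in G t)%:R * e (dot2 x w)) ^+ 2).
  apply: eq_bigr => w _; rewrite /slice_hat big_mkcond; congr (nrm _ ^+ 2).
  by apply: eq_bigr => x _; case: (x \in G t); rewrite ?mul1r ?mul0r.
rewrite (parseval2 e0 eD e_nontriv); congr (_ * _).
under eq_bigr => x _ do rewrite nrm_nat -natrX.
rewrite -natr_sum -sum1_card [in RHS]big_mkcond /=; congr (_%:R).
by apply: eq_bigr => x _; case: (x \in G t).
Qed.

(** The indicator of [G t] is at most [|E f|^2 / L]. Fourier coefficients do not inherit this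
    comparison, but [fiber_parseval] turns both sides into sums of squared line masses, which do. *)
Lemma line_hat_le (f : V -> R[i]) (L : R) (w : V) :
    0 <= L -> (forall t x, x \in G t -> L <= nrm (ext2 e f x t) ^+ 2) ->
    w != 0 ->
  L ^+ 2 * \sum_t \sum_k slice_hat t (scale2 k w) ^+ 2 <=
  2 * p ^+ 5 * (\sum_xi nrm (f xi) ^+ 2) ^+ 2.
Proof.
move=> L0 hL w0; apply: le_trans (line_mass_l2 e0 eD e_nontriv m1_nonsquare f w0).
rewrite mulr_sumr; apply: ler_sum => t _.
under [leRHS]eq_bigr => k _ do under eq_bigr => x _ do rewrite dot2Zr.
rewrite (fiber_parseval e0 eD e_nontriv _ (fun x => dot2 x w)).
have -> : \sum_k slice_hat t (scale2 k w) ^+ 2 =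
    \sum_k nrm (\sum_(x : V) (x \in G t)%:R * e (k * dot2 x w)) ^+ 2.
  apply: eq_bigr => k _; rewrite /slice_hat big_mkcond; congr (nrm _ ^+ 2).
  apply: eq_bigr => x _; rewrite dot2Zr.
  by case: (x \in G t); rewrite ?mul1r ?mul0r.
rewrite (fiber_parseval e0 eD e_nontriv _ (fun x => dot2 x w)) mulrCA.
rewrite ler_wpM2l ?ler0n // mulr_sumr; apply: ler_sum => s _.
rewrite -exprMn -(rmorph_sum (real_complex R)) nrm_real /=; last first.
  by apply: sumr_ge0 => x _; apply: sqr_ge0.
rewrite -natr_sum nrm_nat natr_sum ler_sqr ?nnegrE ?mulr_ge0 ?sumr_ge0 //; last first.
  by move=> x _; apply: sqr_ge0.
rewrite mulr_sumr; apply: ler_sum => x _.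
by have [/hL|_] := boolP (x \in G t); rewrite ?mulr1 // mulr0 sqr_ge0.
Qed.

(** The inverse Fourier transform of the surface measure, up to the factor [p^-2]. *)
Definition gauss_kernel (z : V) (tau : F) : R[i] :=
  \sum_(xi : V) e (dot2 z xi + tau * dot2 xi xi).

Lemma gauss_kernel0 z : gauss_kernel z 0 = ((z == 0)%:R * p ^+ 2)%:C.
Proof.
by rewrite -(sum_char2 e0 eD e_nontriv); apply: eq_bigr => xi _; rewrite mul0r addr0.
Qed.

(** In the squared modulus, shifting [xi] by [eta] leaves a phase linear in [eta] with frequency
    [2 tau xi], so only [xi = 0] survives. *)
Lemma nrm_gauss_kernel tau : tau != 0 -> nrm (gauss_kernel 0 tau) = p.
Proof.
move=> t0; have n0 := two_neq0 m1_nonsquare.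
suff h : nrm (gauss_kernel 0 tau) ^+ 2 = p ^+ 2.
  by apply/eqP; move/eqP: h; rewrite eqrXn2 ?nrm_ge0 ?ler0n.
apply: nrm_sqr_eq; rewrite /gauss_kernel rmorph_sum big_distrlr /=.
transitivity (\sum_(xi : V) e (tau * dot2 xi xi) *
    \sum_(eta : V) e (dot2 (scale2 (2 * tau) xi) eta)).
  rewrite exchange_big /=.
  under eq_bigr => eta _ do rewrite (reindex_inj (addIr eta)) /=.
  rewrite exchange_big /=; apply: eq_bigr => xi _.
  rewrite mulr_sumr; apply: eq_bigr => eta _.
  rewrite (char_conj e0 eD) -eD; congr (e _).
  by rewrite !dot20l !dot2E (dot2C eta xi); ring.
under eq_bigr => xi _ do rewrite (sum_char2 e0 eD e_nontriv).
rewrite (bigD1 (0 : V)) //= big1 ?addr0.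
  by rewrite dot20l mulr0 e0 mul1r scale2_eq0 eqxx orbT mul1r.
move=> xi xin; rewrite scale2_eq0 (negbTE xin) orbF mulf_eq0 (negbTE n0) (negbTE t0).
by rewrite mul0r mulr0.
Qed.

(** Completing the square, with the shift [z / (2 tau)]. *)
Lemma gauss_kernelE z tau : tau != 0 ->
  gauss_kernel z tau = e (- (dot2 z z / (4 * tau))) * gauss_kernel 0 tau.
Proof.
move=> t0; have n0 := two_neq0 m1_nonsquare.
rewrite /gauss_kernel mulr_sumr.
rewrite (reindex_inj (addIr (- scale2 (2 * tau)^-1 z))) /=.
apply: eq_bigr => xi _; rewrite -eD !dot20l; congr (e _).
have n4 : 4 != 0 :> F by rewrite -[4]/((2 * 2)%:R) natrM mulf_neq0.
rewrite !dot2E (dot2C z xi); field.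
by rewrite n0 n4 t0.
Qed.

Variable g : F -> V -> R[i].
Hypothesis g_out : forall t x, x \notin G t -> g t x = 0.
Hypothesis g_le1 : forall t x, nrm (g t x) <= 1.

(** Contribution of the slice [a] at time [t], with the constant [gauss_kernel 0 (t - a)], of
    modulus [p], divided out. *)
Definition evolved (a t : F) (x : V) : R[i] :=
  \sum_y g a y * e (- (dot2 (x - y) (x - y) / (4 * (t - a)))).

(** The pairing is moved to the adjoint [H], and the norm of [H] is expanded with kernel
    [gauss_kernel (x - y) (t - a)]. For [a = t] this is a point mass, giving the first term; the
    other slices give the second. *)
Lemma duality (f : V -> R[i]) :
  nrm (\sum_t \sum_x ext2 e f x t * conjc (g t x)) ^+ 2 <=
  (\sum_xi nrm (f xi) ^+ 2) *
  (p ^+ 2 * \sum_t N t +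
   p * \sum_a \sum_(t | t != a) \sum_(x in G t) nrm (evolved a t x)).
Proof.
pose H xi := \sum_a \sum_y g a y * e (- (dot2 y xi + a * dot2 xi xi)).
have -> : \sum_t \sum_x ext2 e f x t * conjc (g t x) = \sum_xi f xi * conjc (H xi).
  under [RHS]eq_bigr => xi _.
    rewrite rmorph_sum mulr_sumr /=.
    under eq_bigr => a _ do rewrite rmorph_sum mulr_sumr /=.
  over.
  rewrite [RHS]exchange_big /=; apply: eq_bigr => t _.
  rewrite [RHS]exchange_big /=; apply: eq_bigr => x _.
  rewrite mulr_suml; apply: eq_bigr => xi _.
  by rewrite rmorphM /= -(charN e0 eD) opprK; ring.
apply: le_trans (cauchy_schwarz_nrm _ _ _ _) _.
under [X in _ * X <= _]eq_bigr => xi _ do rewrite nrm_conj.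
apply: ler_wpM2l; first by apply: sumr_ge0 => xi _; apply: sqr_ge0.
have -> : \sum_xi nrm (H xi) ^+ 2 =
    nrm (\sum_t \sum_x conjc (g t x) * \sum_a \sum_y g a y * gauss_kernel (x - y) (t - a)).
  have S0 : 0 <= \sum_xi nrm (H xi) ^+ 2 by apply: sumr_ge0 => xi _; apply: sqr_ge0.
  rewrite -(nrm_real S0); congr nrm; rewrite rmorph_sum /=.
  under eq_bigr => xi _.
    rewrite nrm_sqr mulrC {1}/H rmorph_sum mulr_suml /=.
    under eq_bigr => t _ do rewrite rmorph_sum mulr_suml /=.
  over.
  rewrite exchange_big /=; apply: eq_bigr => t _.
  rewrite exchange_big /=; apply: eq_bigr => x _.
  under eq_bigr => xi _ do rewrite rmorphM /= -mulrA.
  rewrite -mulr_sumr; congr (_ * _).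
  under [LHS]eq_bigr => xi _.
    rewrite /H mulr_sumr; under eq_bigr => a _ do rewrite mulr_sumr /=.
  over.
  rewrite exchange_big /=; apply: eq_bigr => a _.
  rewrite exchange_big /=; apply: eq_bigr => y _.
  rewrite mulr_sumr; apply: eq_bigr => xi _.
  rewrite -(charN e0 eD) opprK mulrCA -eD; congr (_ * e _).
  by rewrite dot2Bl; ring.
apply: le_trans (nrm_sum _ _ _) _.
have slice t : nrm (\sum_x conjc (g t x) * \sum_a \sum_y g a y * gauss_kernel (x - y) (t - a))
   <= p ^+ 2 * N t + p * \sum_(a | t != a) \sum_(x in G t) nrm (evolved a t x).
  apply: le_trans (nrm_sum _ _ _) _.
  rewrite (bigID (mem (G t))) /= [X in _ + X]big1 ?addr0; last first.
    by move=> x xG; rewrite g_out // conjc0 mul0r Normc.normc0.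
  rewrite exchange_big mulr_sumr mulr_natr -sumr_const /= -big_split /=.
  apply: ler_sum => x xG; rewrite Normc.normcM nrm_conj.
  apply: le_trans (ler_piMl (nrm_ge0 _) (g_le1 _ _)) _.
  apply: le_trans (nrm_sum _ _ _) _.
  rewrite (bigD1 t) //= subrr; apply: lerD.
    under eq_bigr => y _ do rewrite gauss_kernel0 subr_eq0.
    rewrite (bigD1 x) //= eqxx big1 ?addr0 ?mul1r; last first.
      by move=> y yx; rewrite eq_sym (negbTE yx) mul0r mulr0.
    rewrite Normc.normcM nrm_real ?sqr_ge0 //.
    by rewrite ler_piMl ?sqr_ge0.
  rewrite mulr_sumr; under [leRHS]eq_bigl => a do rewrite eq_sym.
  apply: ler_sum => a ta; have ta0 : t - a != 0 by rewrite subr_eq0 eq_sym.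
  under eq_bigr => y _ do rewrite (gauss_kernelE _ ta0) mulrA.
  by rewrite -mulr_suml Normc.normcM (nrm_gauss_kernel ta0) mulrC.
apply: le_trans (ler_sum _ (fun t _ => slice t)) _.
by rewrite big_split /= -!mulr_sumr (exchange_big_dep predT).
Qed.


(** With the displacement [2 tau w], the quotient of two quadratic phases of [evolved] is
    [e (dot2 x w)] times the phase written here. *)
Definition autocorr (a tau : F) (w : V) : R[i] :=
  \sum_(y : V) g a (y + scale2 (2 * tau) w) * conjc (g a y) *
          e (- dot2 y w - tau * dot2 w w).

Lemma nrm_g_le t x : nrm (g t x) <= (x \in G t)%:R.
Proof. by have [xG|xG] := boolP (x \in G t); [exact: g_le1 | rewrite g_out // Normc.normc0].
Qed.

Lemma nrm_pair_le a d y :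
  nrm (g a (y + d) * conjc (g a y)) <= ((y \in G a) && (y + d \in G a))%:R.
Proof.
rewrite Normc.normcM nrm_conj -mulnb natrM mulrC.
by apply: ler_pM (nrm_g_le _ _) (nrm_g_le _ _); apply: nrm_ge0.
Qed.

Lemma nrm_autocorr_le a tau w :
  nrm (autocorr a tau w) <= overlap R (G a) (scale2 (2 * tau) w).
Proof.
apply: le_trans (nrm_sum _ _ _) _; apply: ler_sum => y _.
by rewrite Normc.normcM (char_nrm e0 eD) mulr1 nrm_pair_le.
Qed.

(** In the expanded square, the second point is written as [y + 2 (t - a) w]; the sum over [x] in
    [G t] then becomes a Fourier coefficient at [w]. *)
Lemma evolved_l2_le a t : t != a ->
  \sum_(x in G t) nrm (evolved a t x) ^+ 2 <=
  \sum_w nrm (autocorr a (t - a) w) * slice_hat t w.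
Proof.
move=> ta; have n0 := two_neq0 m1_nonsquare.
have tau0 : t - a != 0 by rewrite subr_eq0.
have n4 : 4 != 0 :> F by rewrite -[4]/((2 * 2)%:R) natrM mulf_neq0.
have S0 : 0 <= \sum_(x in G t) nrm (evolved a t x) ^+ 2.
  by apply: sumr_ge0 => x _; apply: sqr_ge0.
rewrite -(nrm_real S0).
have -> : (\sum_(x in G t) nrm (evolved a t x) ^+ 2)%:C =
    \sum_w autocorr a (t - a) w * \sum_(x in G t) e (dot2 x w).
  under [RHS]eq_bigr => w _ do rewrite mulr_sumr.
  rewrite rmorph_sum [RHS]exchange_big /=; apply: eq_bigr => x _.
  rewrite nrm_sqr /evolved rmorph_sum big_distrlr /= exchange_big /=.
  under [RHS]eq_bigr => w _ do rewrite /autocorr mulr_suml.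
  rewrite [RHS]exchange_big /=; apply: eq_bigr => y _.
  have inj : injective (fun w => y + scale2 (2 * (t - a)) w).
    by apply: inj_comp (addrI y) (scale2_inj (mulf_neq0 n0 tau0)).
  rewrite (reindex_inj inj) /=; apply: eq_bigr => w _.
  rewrite rmorphM /= -[RHS]mulrA -eD mulrACA (char_conj e0 eD); congr (_ * e _).
  rewrite !dot2E (dot2C y x) (dot2C w x) (dot2C w y); field.
  by rewrite n4 tau0.
apply: le_trans (nrm_sum _ _ _) _; apply: ler_sum => w _.
by rewrite Normc.normcM.
Qed.

(** For a fixed displacement [d = 2 tau w], the phase depends on [tau] only through
    [s = - (2 tau)^-1], as [e (s * dot2 y d)]. Parseval in [s] leaves pairs [y], [y'] with [y' - y]
    orthogonal to [d], that is, rectangles. *)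
Lemma autocorr_l2_le a :
  \sum_(tau | tau != 0) \sum_(w : V | w != 0) nrm (autocorr a tau w) ^+ 2 <=
  p * \sum_(d : V | d != 0) \sum_s
     (\sum_(y : V | dot2 y d == s) ((y \in G a) && (y + d \in G a))%:R) ^+ 2.
Proof.
have n0 := two_neq0 m1_nonsquare.
pose phi d s := nrm (\sum_(y : V) g a (y + d) * conjc (g a y) * e (s * dot2 y d)) ^+ 2.
have step tau : tau != 0 -> \sum_(w : V | w != 0) nrm (autocorr a tau w) ^+ 2 =
    \sum_(d : V | d != 0) phi d (- (2 * tau)^-1).
  move=> tau0; have nt : 2 * tau != 0 by rewrite mulf_neq0.
  have c0 : (2 * tau)^-1 != 0 by rewrite invr_neq0.
  rewrite (reindex_inj (scale2_inj c0)) /=; apply: eq_big => d.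
    by rewrite scale2_eq0 (negbTE c0).
  move=> _; rewrite /autocorr /phi.
  under eq_bigr => y _ do
    rewrite scale2A (mulfV nt) scale21 eD mulrA.
  rewrite -mulr_suml Normc.normcM (char_nrm e0 eD) mulr1; congr (nrm _ ^+ 2).
  by apply: eq_bigr => y _; rewrite dot2Zr mulNr.
rewrite (eq_bigr _ step) exchange_big /= mulr_sumr; apply: ler_sum => d _.
(* Since [0^-1 = 0], this map permutes all of [F]; the added term at [tau = 0] is nonnegative. *)
have inj : injective (fun tau : F => - (2 * tau)^-1).
  by apply: inj_comp oppr_inj (inj_comp invr_inj (mulfI n0)).
apply: (@le_trans _ _ (\sum_s phi d s)).
  rewrite [leRHS](reindex_inj inj) /= [leRHS](bigID (fun tau => tau != 0)) /=.
  by rewrite lerDl sumr_ge0 // => *; apply: sqr_ge0.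
rewrite /phi (fiber_parseval e0 eD e_nontriv _ (fun y => dot2 y d)).
rewrite ler_wpM2l ?ler0n //; apply: ler_sum => s _.
rewrite ler_sqr ?nnegrE ?nrm_ge0 ?sumr_ge0 //.
apply: le_trans (nrm_sum _ _ _) _; apply: ler_sum => y _; exact: nrm_pair_le.
Qed.

End Duality.

(** * Trapezoids and corners *)

Section Counting.
Variables (R : rcfType) (F : finFieldType).
Hypothesis m1_nonsquare : forall x : F, x ^+ 2 != -1.

Local Notation p := (#|F|%:R : R).
Local Notation V := (F * F)%type.

Lemma sum_nonzero : \sum_(k : F | k != 0) 1 = p - 1.
Proof.
have : \sum_(k : F) 1 = p by rewrite sumr_const.
by rewrite (bigD1 0) //= => <-; rewrite addrC addrK.
Qed.

Lemma card_field_gt1 : 1 < p.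
Proof. by rewrite ltr1n; exact: card_finNzRing_gt1. Qed.

(** Passes from vectors to directions: each nonzero vector occurs [p - 1] times as a multiple of a
    nonzero vector. *)
Lemma sum_scale2 (h : V -> R) :
  \sum_(w : V | w != 0) \sum_(k : F | k != 0) h (scale2 k w) =
  (p - 1) * \sum_(w : V | w != 0) h w.
Proof.
rewrite exchange_big /= -sum_nonzero mulr_suml; apply: eq_bigr => k k0.
rewrite mul1r [RHS](reindex_inj (scale2_inj k0)) /=; apply: eq_bigl => w.
by rewrite scale2_eq0 (negbTE k0).
Qed.

Lemma sum_pair2 (h : F * F -> R) :
  \sum_(u : F * F | u.2 != 0) h u = \sum_a \sum_(al | al != 0) h (a, al).
Proof.
rewrite (pair_big predT (fun al : F => al != 0) (fun a al => h (a, al))) /=.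
by apply: eq_big => [[a al]|[a al] _].
Qed.

(* Two distinct incidences [al = 2 (t - a) k] and [be = 2 (t - b) k] determine
   [(t, k)]; this is what makes trapezoids appear. *)
Lemma pencil_l2_le (rho : F * F -> R) : (forall u, 0 <= rho u) ->
  \sum_t \sum_(k | k != 0) (\sum_(a | t != a) rho (a, 2 * (t - a) * k)) ^+ 2 <=
  (\sum_a \sum_(al | al != 0) rho (a, al)) ^+ 2 +
  p * \sum_a \sum_(al | al != 0) rho (a, al) ^+ 2.
Proof.
move=> r0; have n0 := two_neq0 m1_nonsquare.
pose inc (u : F * F) (v : F * F) := (v.2 != 0) && (u.2 == 2 * (v.1 - u.1) * v.2).
have expand t k : k != 0 -> \sum_(a | t != a) rho (a, 2 * (t - a) * k) =
    \sum_(u | u.2 != 0) (inc u (t, k))%:R * rho u.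
  move=> k0; rewrite sum_pair2 /= big_mkcond; apply: eq_bigr => a _ /=; rewrite /inc /= k0 /=.
  case: ifP => [ta|/negbFE/eqP ->]; last first.
    rewrite big1 // => al al0; rewrite subrr mulr0 mul0r.
    by rewrite (negbTE al0) mul0r.
  rewrite (bigD1 (2 * (t - a) * k)) /=; last first.
    by rewrite !mulf_neq0 // subr_eq0.
  rewrite eqxx mul1r big1 ?addr0 // => al /andP[_ /negbTE ->].
  by rewrite mul0r.
(* On the diagonal [u = v] each [k] leaves at most one [t], whence at most [p] common incidences. *)
have count u v : \sum_t \sum_(k | k != 0) (inc u (t, k))%:R * (inc v (t, k))%:R
    <= 1 + p * (u == v)%:R :> R.
  have [<-|uv] := eqVneq u v.
    rewrite mulr1 (exchange_big_dep predT) //=.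
    apply: (@le_trans _ _ (\sum_(k : F) 1)); last first.
      by rewrite sumr_const lerDr ler01.
    apply: ler_sum => k _; rewrite big_mkcond /=.
    apply: (@le_trans _ _ (\sum_(t | inc u (t, k)) 1)).
      rewrite [leRHS]big_mkcond /=; apply: ler_sum => t _.
      by case: (inc u (t, k)); case: (k != 0); rewrite /= ?mulr1 ?mul0r ?mulr0 ?ler01.
    apply: sum_cond_le => // t t' /andP[k0 /eqP /= h] /andP[_ /eqP /= h'].
    move: h; rewrite h' => /(mulIf k0)/(mulfI n0)/addIr //.
  rewrite mulr0 addr0 pair_big /=.
  apply: (@le_trans _ _ (\sum_(w | inc u w && inc v w) 1)).
    rewrite big_mkcond [leRHS]big_mkcond /=; apply: ler_sum => -[t k] _ /=.
    by case: (inc u _); case: (inc v _); case: (k != 0); rewrite /= ?mulr1 ?mul0r ?mulr0 ?ler01.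
  apply: sum_cond_le => // -[t k] [t' k'] /=.
  case: u v uv => [a al] [b be]; rewrite /inc /= => uv.
  move=> /andP[/andP[k0 /eqP h1] /andP[_ /eqP h2]].
  move=> /andP[/andP[k'0 /eqP h1'] /andP[_ /eqP h2']].
  have ab : b - a != 0.
    apply: contra uv => /eqP ab; have -> : b = a by apply/eqP; rewrite -subr_eq0 ab.
    by rewrite h1 h2 (_ : b = a) //; apply/eqP; rewrite -subr_eq0 ab.
  have kk : k = k'.
    apply: (mulfI (mulf_neq0 n0 ab)).
    have -> : 2 * (b - a) * k = al - be by rewrite h1 h2; ring.
    by rewrite h1' h2'; ring.
  move: h1; rewrite h1' kk => /(mulIf k'0)/(mulfI n0)/addIr <- //.
rewrite (eq_bigr (fun t => \sum_(k | k != 0) \sum_(u | u.2 != 0) \sum_(v | v.2 != 0)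
  rho u * rho v * ((inc u (t, k))%:R * (inc v (t, k))%:R))); last first.
  move=> t _; apply: eq_bigr => k k0; rewrite (expand _ _ k0) expr2 big_distrlr /=.
  by apply: eq_bigr => u _; apply: eq_bigr => v _; rewrite mulrACA mulrC.
rewrite -(sum_pair2 rho) -(sum_pair2 (fun u => rho u ^+ 2)).
apply: (@le_trans _ _ (\sum_(u | u.2 != 0) \sum_(v | v.2 != 0)
   rho u * rho v * (1 + p * (u == v)%:R))).
  under eq_bigr => t _ do rewrite exchange_big /=.
  rewrite exchange_big /=; apply: ler_sum => u _.
  under eq_bigr => t _ do rewrite exchange_big /=.
  rewrite exchange_big /=; apply: ler_sum => v _.
  apply: le_trans (ler_wpM2l _ (count u v)); last by rewrite mulr_ge0.
  by rewrite mulr_sumr; apply: ler_sum => t _; rewrite mulr_sumr.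
rewrite expr2 big_distrlr mulr_sumr -big_split /=; apply: ler_sum => u u0.
under eq_bigr => v _ do rewrite mulrDr mulr1.
rewrite big_split /= lerD2l (bigD1 u) //= eqxx mulr1 big1 ?addr0.
  by rewrite mulrC expr2.
by move=> v /andP[_ vu]; rewrite eq_sym (negbTE vu) !mulr0.
Qed.

(** * Pairs of points of a planar set with a given difference *)

Section Overlap.
Variable S : {set V}.
Local Notation n := (#|S|%:R : R).

Lemma sum_indicator : \sum_(y : V) (y \in S)%:R = n.
Proof.
rewrite -natr_sum -sum1_card [in RHS]big_mkcond /=; congr (_%:R).
Qed.

Lemma overlap_ge0 d : 0 <= overlap R S d.
Proof. by apply: sumr_ge0 => y _; rewrite ler0n. Qed.

Lemma overlap0 : overlap R S 0 = n.
Proof. by rewrite -sum_indicator; apply: eq_bigr => y _; rewrite addr0 andbb. Qed.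

Lemma overlap_le d : overlap R S d <= n.
Proof.
rewrite -sum_indicator; apply: ler_sum => y _.
by case: (y \in S) => //; case: (_ \in S); rewrite ?ler01.
Qed.

Lemma sum_overlap : \sum_(d : V) overlap R S d = n ^+ 2.
Proof.
rewrite exchange_big /= expr2 -{1}sum_indicator mulr_suml; apply: eq_bigr => y _.
under eq_bigr => d _ do rewrite -mulnb natrM.
rewrite -mulr_sumr -sum_indicator; congr (_ * _).
by rewrite [RHS](reindex_inj (addrI y)).
Qed.

Lemma sum_overlap_neq0 : \sum_(d : V | d != 0) overlap R S d = n ^+ 2 - n.
Proof. by rewrite -sum_overlap [in RHS](bigD1 (0 : V)) //= overlap0; ring. Qed.

Lemma sum_overlap_sqr_le : \sum_(d : V | d != 0) overlap R S d ^+ 2 <= n ^+ 3.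
Proof.
rewrite exprS -sum_overlap mulr_sumr big_mkcond; apply: ler_sum => d _.
have h : overlap R S d ^+ 2 <= n * overlap R S d.
  by rewrite expr2 ler_wpM2r ?overlap_ge0 ?overlap_le.
by case: ifP => // _; apply: le_trans h; apply: sqr_ge0.
Qed.

Lemma colinearP (w d : V) : w != 0 -> w.1 * d.2 = w.2 * d.1 ->
  exists k, d = scale2 k w.
Proof.
case: w d => [w1 w2] [d1 d2] /=; rewrite -pair_eqE /= /pair_eq /= negb_and => h hd.
have [w10|w10] := eqVneq w1 0.
  move: h hd; rewrite w10 eqxx /= mul0r => w20 /esym/eqP.
  rewrite mulf_eq0 (negbTE w20) /= => /eqP ->.
  by exists (d2 / w2); rewrite /scale2 /= mulr0 divfK.
exists (d1 / w1); rewrite /scale2 /= divfK //; congr (_, _).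
by apply: (mulfI w10); rewrite hd; field.
Qed.

(** Cauchy-Schwarz over the [p] lines parallel to [w], which are the fibres of [q]; two points of
    one line differ by a multiple of [w]. *)
Lemma line_overlap_ge (w : V) : w != 0 ->
  n ^+ 2 <= p * \sum_k overlap R S (scale2 k w).
Proof.
move=> w0; pose q (y : V) := w.1 * y.2 - w.2 * y.1.
have -> : n = \sum_s \sum_(y : V | q y == s) (y \in S)%:R.
  by rewrite -sum_indicator (partition_big q predT).
apply: le_trans (sum_sqr_le_card _ _ _) _.
rewrite sumr_const ler_wpM2l ?ler0n //.
under eq_bigr => s _ do rewrite expr2 big_distrlr /=.
rewrite exchange_big /= [leRHS](partition_big q predT) //=.
apply: ler_sum => s _; apply: ler_sum => y /eqP hy.
under [leRHS]eq_bigr => k _ do rewrite -mulnb natrM.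
rewrite -!mulr_sumr ler_wpM2l ?ler0n //.
apply: (@le_trans _ _ (\sum_(z : V) \sum_(k | z == y + scale2 k w) (z \in S)%:R)).
  rewrite big_mkcond; apply: ler_sum => z _; case: ifP => [/eqP hz|_]; last first.
    by apply: sumr_ge0 => k _; rewrite ler0n.
  have [k hk] : exists k, z - y = scale2 k w.
    apply: colinearP => //; apply/eqP; rewrite -subr_eq0 -[X in _ == X](subrr s).
    by rewrite -{1}hz -hy /q /=; apply/eqP; ring.
  rewrite (bigD1 k) /=; last by rewrite -hk addrC subrK.
  by rewrite lerDl sumr_ge0 // => *; rewrite ler0n.
rewrite (exchange_big_dep predT) //=; apply: ler_sum => k _.
by rewrite big_pred1_eq.
Qed.

End Overlap.

End Counting.

Lemma sum_inj_le (R : numDomainType) (T U : finType) (P : pred T) (Q : pred U)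
    (phi : T -> U) (h : U -> R) :
    {in P &, injective phi} -> (forall x, P x -> Q (phi x)) ->
    (forall u, Q u -> 0 <= h u) ->
  \sum_(x | P x) h (phi x) <= \sum_(u | Q u) h u.
Proof.
move=> inj PQ h0; rewrite -(big_imset h inj) /= big_mkcond [leRHS]big_mkcond /=.
apply: ler_sum => u _; case: imsetP => [[x Px ->]|_]; first by rewrite PQ.
by case: ifP => // /h0.
Qed.

(** * Incidence variance and corners in one planar set *)

Section Corners.
Variables (R : rcfType) (F : finFieldType) (e : F -> R[i]).
Hypothesis e0 : e 0 = 1.
Hypothesis eD : forall x y, e (x + y) = e x * e y.
Hypothesis e_nontriv : exists x, e x <> 1.
Hypothesis m1_nonsquare : forall x : F, x ^+ 2 != -1.

Local Notation p := (#|F|%:R : R).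
Local Notation V := (F * F)%type.
Variable S : {set V}.
Local Notation n := (#|S|%:R : R).

Definition line_count (w : V) (s : F) : R := \sum_(y : V | dot2 y w == s) (y \in S)%:R.

Lemma sum_line_count w : \sum_s line_count w s = n.
Proof. by rewrite -sum_indicator [RHS](partition_big (fun y : V => dot2 y w) predT). Qed.

Lemma line_count_scale k w s : k != 0 ->
  line_count (scale2 k w) (k * s) = line_count w s.
Proof.
move=> k0; apply: eq_bigl => y; rewrite dot2Zr.
by apply/eqP/eqP => [/(mulfI k0)|->].
Qed.

Lemma line_count_l2 w : p * \sum_s line_count w s ^+ 2 =
  \sum_k slice_hat e (fun=> S) 0 (scale2 k w) ^+ 2.
Proof.
have -> : \sum_k slice_hat e (fun=> S) 0 (scale2 k w) ^+ 2 =
    \sum_k nrm (\sum_(x : V) (x \in S)%:R * e (k * dot2 x w)) ^+ 2.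
  apply: eq_bigr => k _; rewrite /slice_hat big_mkcond; congr (nrm _ ^+ 2).
  apply: eq_bigr => x _; rewrite dot2Zr.
  by case: (x \in S); rewrite ?mul1r ?mul0r.
rewrite (fiber_parseval e0 eD e_nontriv _ (fun x => dot2 x w)); congr (_ * _).
by apply: eq_bigr => s _; rewrite -natr_sum nrm_nat natr_sum.
Qed.

(** Subtracting the mean [n / p] removes the zero frequency. The other frequencies are met [p - 1]
    times each as [w] varies, and Plancherel bounds their total. *)
Lemma line_variance_le :
  \sum_(w : V | w != 0) \sum_s (line_count w s - n / p) ^+ 2 <= (p - 1) * (p * n).
Proof.
have p0 := card_field_gt0 R F; have pn0 : p != 0 by rewrite gt_eqF.
have step w : p * \sum_s (line_count w s - n / p) ^+ 2 =
    \sum_(k | k != 0) slice_hat e (fun=> S) 0 (scale2 k w) ^+ 2.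
  have -> : \sum_(k | k != 0) slice_hat e (fun=> S) 0 (scale2 k w) ^+ 2 =
      p * \sum_s line_count w s ^+ 2 - n ^+ 2.
    by rewrite line_count_l2 [in RHS](bigD1 0) //= scale20 slice_hat0 // addrC addrK.
  under eq_bigr => s _ do rewrite sqrrB -[_ *+ 2]mulr_natr.
  rewrite big_split sumrB /= -!mulr_suml sum_line_count sumr_const -mulr_natr.
  by field.
rewrite -(ler_pM2l p0) mulr_sumr; under eq_bigr => w _ do rewrite step.
rewrite (sum_scale2 (fun w => slice_hat e (fun=> S) 0 w ^+ 2)) mulrCA.
rewrite ler_wpM2l ?subr_ge0 ?(ltW (card_field_gt1 R F)) //.
rewrite mulrA -expr2 -(slice_hat_l2 e0 eD e_nontriv (fun=> S) 0) big_mkcond.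
by apply: ler_sum => w _; case: ifP => // _; apply: sqr_ge0.
Qed.

(** The corners have one end at [z] and the right angle at [z - d]. Replacing every line count by
    its mean gives [n^2 / p]; the deviations belong to distinct lines and are controlled by
    [line_variance_le] and Cauchy-Schwarz. *)
Lemma pinned_corner_le (z : V) :
  \sum_(d : V | (d != 0) && (z - d \in S)) line_count d (dot2 (z - d) d) <=
  n ^+ 2 / p + Num.sqrt p * n.
Proof.
have p0 := card_field_gt0 R F; have p1 := card_field_gt1 R F.
pose D (d : V) := (d != 0) && (z - d \in S).
have cardD : \sum_(d | D d) 1 <= n.
  rewrite -(sum_indicator R S) big_mkcond [leRHS](reindex_inj (inj_comp (addrI z) oppr_inj)) /=.
  apply: ler_sum => d _; rewrite /D; case: (_ \in S); rewrite ?andbT ?andbF //.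
  by case: ifP; rewrite ?ler01.
pose h (u : V * F) := (line_count u.1 u.2 - n / p) ^+ 2.
(* Each line is taken with its [p - 1] proportional equations, to match the sum over all [w] in
   [line_variance_le]. *)
have hl2 : \sum_(d | D d) \sum_(k : F | k != 0)
    (line_count d (dot2 (z - d) d) - n / p) ^+ 2 <= (p - 1) * (p * n).
  apply: le_trans line_variance_le.
  rewrite !pair_big /=.
  pose phi (u : V * F) := (scale2 u.2 u.1, u.2 * dot2 (z - u.1) u.1).
  rewrite (eq_bigr (fun u => h (phi u))); last first.
    by move=> u /andP[_ u0]; rewrite /h /phi /= line_count_scale.
  rewrite [leRHS](eq_bigl (fun u => u.1 != 0)); last by move=> u; rewrite andbT.
  apply: (sum_inj_le (phi := phi) (h := h)).
  - move=> [d k] [d' k'] /= /andP[/andP[/= d0 _] k0] /andP[/andP[/= d'0 _] k'0].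
    rewrite /phi /= => -[h1 h2 h3].
    have hd : scale2 k d = scale2 k' d' by rewrite /scale2 h1 h2.
    have hd' : d = scale2 (k^-1 * k') d'.
      by rewrite -scale2A -hd scale2A mulVf // scale21.
    set l := k^-1 * k' in hd'.
    have l0 : l != 0 by rewrite mulf_neq0 // invr_neq0.
    have kl : k' = k * l by rewrite /l mulrA mulfV // mul1r.
    clearbody l.
    have dd : dot2 d' d' != 0 by rewrite dot2_eq0.
    suff l1 : l = 1 by rewrite hd' kl l1 scale21 mulr1.
    have : k * l * dot2 d' d' * (l - 1) = 0.
      move: h3; rewrite kl hd' !dot2E => /eqP; rewrite -subr_eq0 => /eqP h3.
      rewrite -[RHS]oppr0 -h3; ring.
    move/eqP; rewrite !mulf_eq0 (negbTE k0) (negbTE l0) (negbTE dd) /= subr_eq0.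
    by move/eqP.
  - by move=> [d k] /andP[/andP[d0 _] k0]; rewrite scale2_eq0 negb_or k0.
  - by move=> u _; apply: sqr_ge0.
rewrite (eq_bigr (fun d => (line_count d (dot2 (z - d) d) - n / p) + n / p * 1)); last first.
  by move=> d _; rewrite mulr1 subrK.
rewrite big_split /= -mulr_sumr addrC; apply: lerD.
  have -> : n ^+ 2 / p = n / p * n by rewrite expr2 mulrAC.
  by rewrite ler_wpM2l // divr_ge0 ?ler0n.
set s := \sum_(i | _) _.
have : s ^+ 2 <= (Num.sqrt p * n) ^+ 2.
  rewrite exprMn sqr_sqrtr ?ler0n // /s.
  apply: le_trans (sum_sqr_le_card _ _ _) _.
  rewrite mulrC expr2 mulrA; apply: ler_pM cardD => //; last 1 first.
  - move: hl2; under eq_bigr => d _.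
      rewrite -[X in \sum_(k | _) X]mul1r -mulr_suml sum_nonzero.
    over.
    by rewrite -mulr_sumr ler_pM2l // subr_gt0.
  - by apply: sumr_ge0 => d _; apply: sqr_ge0.
  by apply: sumr_ge0.
move=> h2; apply: le_trans (ler_norm _) _.
by rewrite -ler_sqr ?nnegrE ?mulr_ge0 ?sqrtr_ge0 ?ler0n // real_normK ?num_real.
Qed.

(** The square counts rectangles [y, y + d, y', y' + d]. Forgetting the vertex [y' + d] leaves a
    corner at [y] with ends [z = y + d] and [y']. *)
Lemma corner_le :
  \sum_(d : V | d != 0) \sum_s
     (\sum_(y : V | dot2 y d == s) ((y \in S) && (y + d \in S))%:R) ^+ 2 <=
  n ^+ 3 / p + Num.sqrt p * n ^+ 2.
Proof.
have -> : n ^+ 3 / p + Num.sqrt p * n ^+ 2 = n * (n ^+ 2 / p + Num.sqrt p * n) by ring.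
rewrite -{1}(sum_indicator R S) mulr_suml.
apply: (@le_trans _ _ (\sum_(z : V) (z \in S)%:R *
   \sum_(d : V | (d != 0) && (z - d \in S)) line_count d (dot2 (z - d) d))); last first.
  by apply: ler_sum => z _; rewrite ler_wpM2l ?ler0n ?pinned_corner_le.
under [leRHS]eq_bigr => z _ do rewrite mulr_sumr big_mkcondr /=.
rewrite [leRHS]exchange_big /=; apply: ler_sum => d _.
rewrite [leRHS](reindex_inj (addIr d)) /=.
rewrite [leRHS](partition_big (fun y : V => dot2 y d) predT) //=; apply: ler_sum => s _.
rewrite expr2 [leLHS]mulr_suml; apply: ler_sum => y /eqP hy.
rewrite addrK hy -mulnb natrM; case: (y \in S); rewrite ?mul0r // mul1r.
rewrite ler_wpM2l ?ler0n //; apply: ler_sum => z _.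
by case: (z \in S) => //; case: (_ \in S); rewrite ?ler01.
Qed.

End Corners.

Lemma sqrtrD_le (R : rcfType) (x y : R) : 0 <= x -> 0 <= y ->
  Num.sqrt (x + y) <= Num.sqrt x + Num.sqrt y.
Proof.
move=> x0 y0; rewrite -ler_sqr ?nnegrE ?addr_ge0 ?sqrtr_ge0 //.
rewrite sqrrD !sqr_sqrtr ?addr_ge0 // lerD2r lerDl.
by rewrite mulrn_wge0 // mulr_ge0 ?sqrtr_ge0.
Qed.

(** * Trapezoids between two slices *)

Section Trapezoids.
Variables (R : rcfType) (F : finFieldType) (e : F -> R[i]).
Hypothesis e0 : e 0 = 1.
Hypothesis eD : forall x y, e (x + y) = e x * e y.
Hypothesis e_nontriv : exists x, e x <> 1.
Hypothesis m1_nonsquare : forall x : F, x ^+ 2 != -1.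

Local Notation p := (#|F|%:R : R).
Local Notation V := (F * F)%type.
Variable G : F -> {set V}.
Local Notation N a := (#|G a|%:R : R).
Local Notation X := (\sum_a N a).
Local Notation b := (slice_hat e G).

Let p0 : 0 < p := card_field_gt0 R F.
Let p1 : 1 < p := card_field_gt1 R F.
Let X0 : 0 <= X. Proof. exact: sumr_ge0. Qed.

(** The weights [(N a)^-1] come from the Cauchy-Schwarz inequality over slices in
    [level_evolved_le]; an empty slice has weight [0^-1 = 0]. *)
Definition parallel_pairs (w : V) : R :=
  \sum_a (N a)^-1 * \sum_(al : F | al != 0) overlap R (G a) (scale2 al w).

(** By [fiber_parseval], [p] times the number of pairs of points of one slice on a common line with
    normal [w], less the zero frequencies. *)
Definition direction_mass (w : V) : R :=
  \sum_t \sum_(k : F | k != 0) b t (scale2 k w) ^+ 2.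

Lemma parallel_pairs_ge0 w : 0 <= parallel_pairs w.
Proof.
apply: sumr_ge0 => a _; rewrite mulr_ge0 ?invr_ge0 ?ler0n ?sumr_ge0 // => al _.
exact: overlap_ge0.
Qed.

Lemma direction_mass_ge0 w : 0 <= direction_mass w.
Proof. by apply: sumr_ge0 => t _; apply: sumr_ge0 => k _; apply: sqr_ge0. Qed.

Lemma sum_direction_mass_le :
  \sum_(w : V | w != 0) direction_mass w <= (p - 1) * (p ^+ 2 * X).
Proof.
rewrite exchange_big /= [p ^+ 2 * _]mulr_sumr mulr_sumr; apply: ler_sum => t _.
rewrite (sum_scale2 (fun w => b t w ^+ 2)) ler_wpM2l ?subr_ge0 ?(ltW p1) //.
rewrite -(slice_hat_l2 e0 eD e_nontriv) big_mkcond; apply: ler_sum => w _.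
by case: ifP => // _; apply: sqr_ge0.
Qed.

Definition trapezoid_sum : R :=
  \sum_a (N a)^-1 * \sum_(t | t != a) \sum_(w : V | w != 0)
     overlap R (G a) (scale2 (2 * (t - a)) w) * b t w.

(** Along each direction, Cauchy-Schwarz in [(t, k)] separates the overlaps from the Fourier
    coefficients. [pencil_l2_le] bounds the overlap factor by [parallel_pairs w] plus the root of a
    diagonal term [E w], whose total contribution is the first term. *)
Lemma trapezoid_sum_le :
  (p - 1) * trapezoid_sum <=
  (p - 1) * (p * Num.sqrt p * X) +
  \sum_(w : V | w != 0) parallel_pairs w * Num.sqrt (direction_mass w).
Proof.
pose rho w (u : F * F) := (N u.1)^-1 * overlap R (G u.1) (scale2 u.2 w).
have rho0 w u : 0 <= rho w u by rewrite mulr_ge0 ?invr_ge0 ?ler0n ?overlap_ge0.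
pose nn t w := \sum_(a | t != a) rho w (a, 2 * (t - a)).
have -> : trapezoid_sum = \sum_(w : V | w != 0) \sum_t nn t w * b t w.
  rewrite /trapezoid_sum [RHS]exchange_big /=.
  under eq_bigr => a _ do rewrite mulr_sumr.
  rewrite (exchange_big_dep predT) //=; apply: eq_bigr => t _.
  under [RHS]eq_bigr => w _ do rewrite mulr_suml.
  rewrite [RHS]exchange_big /=; apply: eq_bigr => a _.
  by rewrite mulr_sumr; apply: eq_bigr => w _; rewrite mulrA.
rewrite -sum_scale2.
pose E w := p * \sum_a \sum_(al | al != 0) rho w (a, al) ^+ 2.
have E0 w : 0 <= E w.
  by rewrite mulr_ge0 ?ler0n ?sumr_ge0 // => a _; apply: sumr_ge0 => al _; apply: sqr_ge0.
have ppE w : \sum_a \sum_(al | al != 0) rho w (a, al) = parallel_pairs w.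
  by apply: eq_bigr => a _; rewrite mulr_sumr.
have step w : \sum_(k | k != 0) \sum_t nn t (scale2 k w) * b t (scale2 k w) <=
    parallel_pairs w * Num.sqrt (direction_mass w) +
    Num.sqrt (E w) * Num.sqrt (direction_mass w).
  rewrite exchange_big pair_big /=; apply: le_trans (cauchy_schwarz _ _ _ _) _.
  rewrite -mulrDl -(pair_big predT (fun k => k != 0)
      (fun t k => nn t (scale2 k w) ^+ 2)) /=.
  rewrite -(pair_big predT (fun k => k != 0)
      (fun t k => b t (scale2 k w) ^+ 2)) /=.
  apply: ler_wpM2r; first exact: sqrtr_ge0.
  rewrite -{1}(ger0_norm (parallel_pairs_ge0 w)) -sqrtr_sqr.
  apply: le_trans (sqrtrD_le _ (E0 w)); last exact: sqr_ge0.
  rewrite ler_wsqrtr // -ppE; apply: le_trans _ (pencil_l2_le m1_nonsquare (rho0 w)).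
  rewrite le_eqVlt; apply/orP; left; apply/eqP.
  apply: eq_bigr => t _; apply: eq_bigr => k _; congr (_ ^+ 2).
  by apply: eq_bigr => a _; rewrite /rho /= scale2A.
apply: le_trans (ler_sum _ (fun w _ => step w)) _.
rewrite big_split /= addrC lerD2r.
apply: le_trans (cauchy_schwarz _ _ _ _) _.
rewrite (eq_bigr E) => [|w _]; last by rewrite sqr_sqrtr.
rewrite [X in _ * Num.sqrt X](eq_bigr direction_mass) => [|w _]; last by rewrite sqr_sqrtr ?direction_mass_ge0.
have sumE : \sum_(w : V | w != 0) E w <= (p - 1) * (p * X).
  rewrite -mulr_sumr mulrCA ler_wpM2l ?ler0n // exchange_big /= mulr_sumr.
  apply: ler_sum => a _.
  rewrite (sum_scale2 (fun d => ((N a)^-1 * overlap R (G a) d) ^+ 2)).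
  rewrite ler_wpM2l ?subr_ge0 ?(ltW p1) //.
  under eq_bigr => d _ do rewrite exprMn.
  rewrite -mulr_sumr.
  have [->|n0] := eqVneq (N a) 0; first by rewrite invr0 expr0n mul0r.
  apply: le_trans (ler_wpM2l _ (sum_overlap_sqr_le R (G a))) _; first exact: sqr_ge0.
  by rewrite le_eqVlt; apply/orP; left; apply/eqP; field.
rewrite -sqrtrM; last by apply: sumr_ge0.
have -> : (p - 1) * (p * Num.sqrt p * X) =
    Num.sqrt (((p - 1) * (p * X)) * ((p - 1) * (p ^+ 2 * X))).
  have -> : ((p - 1) * (p * X)) * ((p - 1) * (p ^+ 2 * X)) =
     ((p - 1) * (p * X)) ^+ 2 * p by ring.
  rewrite sqrtrM ?sqr_ge0 // sqrtr_sqr ger0_norm; last first.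
    by rewrite !mulr_ge0 ?subr_ge0 ?(ltW p1).
  by ring.
rewrite ler_wsqrtr // ler_pM ?sum_direction_mass_le //; apply: sumr_ge0 => // w _.
exact: direction_mass_ge0.
Qed.

Variable beta : R.
Hypothesis beta_ge0 : 0 <= beta.
Hypothesis direction_mass_le : forall w, w != 0 -> direction_mass w <= beta ^+ 2.

Let sqrt_direction_mass_le w : w != 0 -> Num.sqrt (direction_mass w) <= beta.
Proof.
move=> w0; rewrite -[leRHS]ger0_norm // -sqrtr_sqr ler_wsqrtr //.
exact: direction_mass_le.
Qed.

Lemma sum_parallel_pairs_le :
  \sum_(w : V | w != 0) parallel_pairs w <= (p - 1) * X.
Proof.
rewrite exchange_big /= mulr_sumr; apply: ler_sum => a _.
rewrite -mulr_sumr (sum_scale2 (overlap R (G a))) mulrCA.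
rewrite ler_wpM2l ?subr_ge0 ?(ltW p1) // sum_overlap_neq0.
have [->|n0] := eqVneq (N a) 0; first by rewrite invr0 mul0r.
have -> : (N a)^-1 * (N a ^+ 2 - N a) = N a - 1 by field.
by rewrite lerBlDr lerDl ler01.
Qed.

(** Uses the uniform bound [beta] for every direction and the total of [parallel_pairs]. *)
Lemma trapezoid_sum_le1 : trapezoid_sum <= p * Num.sqrt p * X + beta * X.
Proof.
have p10 : 0 < p - 1 by rewrite subr_gt0.
rewrite -(ler_pM2l p10) mulrDr; apply: le_trans trapezoid_sum_le _.
rewrite lerD2l mulrCA; apply: le_trans (ler_wpM2l beta_ge0 sum_parallel_pairs_le).
rewrite mulr_sumr; apply: ler_sum => w w0.
by rewrite mulrC ler_wpM2r ?parallel_pairs_ge0 ?sqrt_direction_mass_le.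
Qed.

(* Splitting the pairs parallel to [w] into their average over all directions
   and a nonnegative remainder. *)
Lemma trapezoid_sum_le2 :
  trapezoid_sum <= p * Num.sqrt p * X + (beta * p ^+ 2 + X * Num.sqrt (2 * p * X)).
Proof.
have p10 : 0 < p - 1 by rewrite subr_gt0.
have pn0 : p != 0 by rewrite gt_eqF.
rewrite -(ler_pM2l p10) mulrDr; apply: le_trans trapezoid_sum_le _.
rewrite lerD2l.
(* The summand [N a] restores the displacement [al = 0], so that [line_overlap_ge] makes the
   remainder nonnegative. *)
pose v w := \sum_a (N a)^-1 *
  (\sum_(al | al != 0) overlap R (G a) (scale2 al w) + N a - N a ^+ 2 / p).
have v0 w : w != 0 -> 0 <= v w.
  move=> w0; apply: sumr_ge0 => a _; rewrite mulr_ge0 ?invr_ge0 ?ler0n //.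
  rewrite subr_ge0 ler_pdivrMr // mulrC addrC.
  have := line_overlap_ge R (G a) w0.
  by rewrite (bigD1 0) //= scale20 overlap0.
have ppv w : parallel_pairs w <= X / p + v w.
  rewrite mulr_suml -big_split /=; apply: ler_sum => a _.
  have [->|n0] := eqVneq (N a) 0; first by rewrite invr0 !mul0r addr0.
  set z := \sum_(al | _) _.
  have -> : N a / p + (N a)^-1 * (z + N a - N a ^+ 2 / p) = (N a)^-1 * z + 1.
    by field; rewrite n0 pn0.
  by rewrite lerDl ler01.
have sumv : \sum_(w : V | w != 0) v w <= (p - 1) * p ^+ 2.
  rewrite exchange_big /=.
  apply: (@le_trans _ _ (\sum_(a : F) (p - 1) * p)); last first.
    by rewrite sumr_const -[leLHS]mulr_natr expr2 mulrA.
  apply: ler_sum => a _; rewrite -mulr_sumr.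
  have [->|n0] := eqVneq (N a) 0.
    by rewrite invr0 mul0r mulr_ge0 ?ler0n ?(ltW p10).
  have cV : \sum_(w : V | w != 0) 1 = p ^+ 2 - 1 :> R.
    have : \sum_(w : V) 1 = p ^+ 2 :> R by rewrite sumr_const card_prod natrM expr2.
    by rewrite (bigD1 (0 : V)) //= => <-; rewrite addrC addrK.
  rewrite (eq_bigr (fun w => \sum_(al | al != 0) overlap R (G a) (scale2 al w) +
     (N a - N a ^+ 2 / p) * 1)); last by move=> w _; rewrite mulr1 addrA.
  rewrite big_split /= (sum_scale2 (overlap R (G a))) sum_overlap_neq0.
  rewrite -mulr_sumr cV.
  have -> : (N a)^-1 * ((p - 1) * (N a ^+ 2 - N a) + (N a - N a ^+ 2 / p) * (p ^+ 2 - 1)) =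
     (p - 1) * (p - N a / p) by field; rewrite n0 pn0.
  by rewrite ler_wpM2l ?(ltW p10) // lerBlDr lerDl divr_ge0 ?ler0n.
apply: (@le_trans _ _ (\sum_(w : V | w != 0)
   (v w * beta + X / p * Num.sqrt (direction_mass w)))).
  apply: ler_sum => w w0; apply: le_trans (ler_wpM2r (sqrtr_ge0 _) (ppv w)) _.
  by rewrite mulrDl addrC lerD2r ler_wpM2l ?v0 ?sqrt_direction_mass_le.
rewrite big_split /= -mulr_suml -mulr_sumr mulrDr; apply: lerD.
  by rewrite mulrC mulrCA ler_wpM2l.
(* The average [X / p] does not depend on [w], so Cauchy-Schwarz over [w] and the total direction
   mass replace [beta] here. The 2 comes from [p + 1 <= 2 p]. *)
have hs : \sum_(w : V | w != 0) Num.sqrt (direction_mass w) <=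
    (p - 1) * (p * Num.sqrt (2 * p * X)).
  rewrite -ler_sqr ?nnegrE ?sumr_ge0 ?mulr_ge0 ?sqrtr_ge0 ?(ltW p10) ?(ltW p0) //; last first.
    by move=> w _; apply: sqrtr_ge0.
  apply: le_trans (sum_sqr_le_card _ _ _) _.
  under [X in _ * X <= _]eq_bigr => w _ do rewrite sqr_sqrtr ?direction_mass_ge0 //.
  have -> : \sum_(w : V | w != 0) 1 = (p - 1) * (p + 1) :> R.
    have : \sum_(w : V) 1 = p ^+ 2 :> R by rewrite sumr_const card_prod natrM expr2.
    by rewrite (bigD1 (0 : V)) //= => h; apply: (addrI 1); rewrite h; ring.
  rewrite 2!exprMn sqr_sqrtr; last by rewrite !mulr_ge0 ?ler0n.
  apply: (@le_trans _ _ ((p - 1) * (p + 1) * ((p - 1) * (p ^+ 2 * X)))).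
    by rewrite ler_wpM2l ?sum_direction_mass_le // mulr_ge0 ?(ltW p10) // addr_ge0 ?ler0n.
  have -> : (p - 1) * (p + 1) * ((p - 1) * (p ^+ 2 * X)) =
     (p - 1) ^+ 2 * (p ^+ 2 * ((p + 1) * X)) by ring.
  rewrite !ler_wpM2l ?sqr_ge0 // ler_wpM2r //.
  by move: p1; lra.
apply: le_trans (ler_wpM2l _ hs) _; first by rewrite divr_ge0 ?(ltW p0).
by rewrite le_eqVlt; apply/orP; left; apply/eqP; field.
Qed.

End Trapezoids.

(** * The level sets *)

(* To be used with [q = p^(1/4)] and [h = X^(1/2)]; the last three hypotheses are
   the two trapezoid bounds and the corner bound. *)
Lemma level_set_arith (R : realFieldType) (q h l S : R) :
    1 <= q -> 0 <= h -> 0 < l -> l <= 1 ->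
    l ^+ 2 * h ^+ 2 <= q ^+ 4 ->
    l ^+ 2 * h ^+ 2 <= 2 \/ l ^+ 4 * q ^+ 8 * h ^+ 4 <= 4 * (2 * q ^+ 6 * h ^+ 2 + S) ->
    l ^+ 2 * S <= 2 * q ^+ 2 * h ^+ 2 ->
    l ^+ 2 * S <= 2 * q ^+ 10 + 2 * q ^+ 2 * h ^+ 3 * l ^+ 2 ->
    S <= q ^+ 11 * h ->
  l ^+ 24 * h ^+ 14 <= 2 ^+ 22.
Proof.
move=> q1 h0 l0 l1 hP hZ hA hB hC.
have q0 : 0 < q by lra.
have q0' := ltW q0; have l0' := ltW l0.
have qn m : 0 < q ^+ m by rewrite exprn_gt0.
have ln m : 0 < l ^+ m by rewrite exprn_gt0.
have hn m : 0 <= h ^+ m by rewrite exprn_ge0.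
have [->|hneq] := eqVneq h 0; first by rewrite (expr0n _ 14) /= mulr0 exprn_ge0.
have hp : 0 < h by rewrite lt_def hneq.
have [hs|{hZ}hZ] := hZ.
  have -> : l ^+ 24 * h ^+ 14 = (l ^+ 2 * h ^+ 2) ^+ 7 * l ^+ 10 by ring.
  have le10 : l ^+ 10 <= 1 by rewrite exprn_ile1 // ltW.
  have le7 : (l ^+ 2 * h ^+ 2) ^+ 7 <= 2 ^+ 7.
    by apply: lerXn2r; rewrite ?nnegrE ?mulr_ge0 ?exprn_ge0.
  apply: le_trans (ler_pM _ _ le7 le10) _; rewrite ?exprn_ge0 ?mulr_ge0 ?exprn_ge0 //.
  by rewrite mulr1; lra.
have [small|big] := lerP S (2 * q ^+ 6 * h ^+ 2).
  have k1 : l ^+ 4 * q ^+ 2 * h ^+ 2 <= 16.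
    rewrite -(ler_pM2l (qn 6)) -(ler_pM2l (exprn_gt0 2 hp)).
    apply: le_trans (_ : l ^+ 4 * q ^+ 8 * h ^+ 4 <= _); last by lra.
    by rewrite le_eqVlt; apply/orP; left; apply/eqP; ring.
  have k2 : l ^+ 4 * h ^+ 2 <= 16.
    apply: le_trans k1; rewrite ler_wpM2r // ler_peMr ?(ltW (ln _)) //.
    by rewrite exprn_ege1.
  (* The powers 4 and 2 are chosen to cancel [q ^+ 8]. *)
  have k3 : (l ^+ 4 * q ^+ 2 * h ^+ 2) ^+ 4 * (l ^+ 2 * h ^+ 2) ^+ 2 <= 16 ^+ 4 * (q ^+ 4) ^+ 2.
    apply: ler_pM; rewrite ?exprn_ge0 ?mulr_ge0 ?exprn_ge0 //.
      by apply: lerXn2r; rewrite ?nnegrE ?mulr_ge0 ?exprn_ge0.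
    by apply: lerXn2r; rewrite ?nnegrE ?mulr_ge0 ?exprn_ge0.
  have k4 : l ^+ 20 * h ^+ 12 <= 2 ^+ 16.
    rewrite -(ler_pM2l (qn 8)); apply: le_trans (_ : _ <= 16 ^+ 4 * (q ^+ 4) ^+ 2) _.
      by apply: le_trans k3; rewrite le_eqVlt; apply/orP; left; apply/eqP; ring.
    by rewrite le_eqVlt; apply/orP; left; apply/eqP; ring.
  have -> : l ^+ 24 * h ^+ 14 = (l ^+ 20 * h ^+ 12) * (l ^+ 4 * h ^+ 2) by ring.
  apply: le_trans (ler_pM _ _ k4 k2) _; rewrite ?mulr_ge0 ?exprn_ge0 //.
  by lra.
have {}hZ : l ^+ 4 * q ^+ 8 * h ^+ 4 <= 8 * S by lra.
have kA : l ^+ 6 * q ^+ 6 * h ^+ 2 <= 16.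
  rewrite -(ler_pM2l (qn 2)) -(ler_pM2l (exprn_gt0 2 hp)).
  have := ler_wpM2l (ltW (ln 2)) hZ.
  have -> : l ^+ 2 * (l ^+ 4 * q ^+ 8 * h ^+ 4) =
    h ^+ 2 * (q ^+ 2 * (l ^+ 6 * q ^+ 6 * h ^+ 2)) by ring.
  move: hA; lra.
have kC : l ^+ 4 * h ^+ 3 <= 8 * q ^+ 3.
  rewrite -(ler_pM2l (qn 8)) -(ler_pM2l hp).
  apply: le_trans (_ : l ^+ 4 * q ^+ 8 * h ^+ 4 <= _).
    by rewrite le_eqVlt; apply/orP; left; apply/eqP; ring.
  apply: le_trans hZ _; apply: le_trans (_ : 8 * (q ^+ 11 * h) <= _); first by lra.
  by rewrite le_eqVlt; apply/orP; left; apply/eqP; ring.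
have hB' : l ^+ 6 * q ^+ 8 * h ^+ 4 <= 16 * q ^+ 10 + 16 * (q ^+ 2 * h ^+ 3 * l ^+ 2).
  have := ler_wpM2l (ltW (ln 2)) hZ.
  have -> : l ^+ 2 * (l ^+ 4 * q ^+ 8 * h ^+ 4) = l ^+ 6 * q ^+ 8 * h ^+ 4 by ring.
  move: hB; lra.
(* Either term of [hB] may dominate. In the first case [kA * kB^3] eliminates [q], in the second
   [kB^2 * kC^4]; the latter gives the constant [2 ^+ 22]. *)
have [b1|b2] := lerP (q ^+ 2 * h ^+ 3 * l ^+ 2) (q ^+ 10).
  have kB : l ^+ 6 * h ^+ 4 <= 32 * q ^+ 2.
    rewrite -(ler_pM2l (qn 8)); apply: le_trans (_ : l ^+ 6 * q ^+ 8 * h ^+ 4 <= _).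
      by rewrite le_eqVlt; apply/orP; left; apply/eqP; ring.
    apply: le_trans (_ : 32 * q ^+ 10 <= _); first by lra.
    by rewrite le_eqVlt; apply/orP; left; apply/eqP; ring.
  rewrite -(ler_pM2l (qn 6)).
  have -> : q ^+ 6 * (l ^+ 24 * h ^+ 14) =
    (l ^+ 6 * q ^+ 6 * h ^+ 2) * (l ^+ 6 * h ^+ 4) ^+ 3 by ring.
  apply: le_trans (_ : 16 * (32 * q ^+ 2) ^+ 3 <= _).
    apply: ler_pM; rewrite ?exprn_ge0 ?mulr_ge0 ?exprn_ge0 //.
    by apply: lerXn2r; rewrite ?nnegrE ?mulr_ge0 ?exprn_ge0.
  have -> : 16 * (32 * q ^+ 2) ^+ 3 = q ^+ 6 * 2 ^+ 19 by ring.
  by rewrite ler_wpM2l ?exprn_ge0 // ler_weXn2l // ler1n.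
have kB : l ^+ 4 * q ^+ 6 * h <= 32.
  rewrite -(ler_pM2l (qn 2)) -(ler_pM2l (exprn_gt0 3 hp)) -(ler_pM2l (ln 2)).
  apply: le_trans (_ : l ^+ 6 * q ^+ 8 * h ^+ 4 <= _).
    by rewrite le_eqVlt; apply/orP; left; apply/eqP; ring.
  apply: le_trans (_ : 32 * (q ^+ 2 * h ^+ 3 * l ^+ 2) <= _); first by lra.
  by rewrite le_eqVlt; apply/orP; left; apply/eqP; ring.
rewrite -(ler_pM2l (qn 12)).
have -> : q ^+ 12 * (l ^+ 24 * h ^+ 14) =
  (l ^+ 4 * q ^+ 6 * h) ^+ 2 * (l ^+ 4 * h ^+ 3) ^+ 4 by ring.
apply: le_trans (_ : 32 ^+ 2 * (8 * q ^+ 3) ^+ 4 <= _).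
  apply: ler_pM; rewrite ?exprn_ge0 ?mulr_ge0 ?exprn_ge0 //.
    by apply: lerXn2r; rewrite ?nnegrE ?mulr_ge0 ?exprn_ge0.
  by apply: lerXn2r; rewrite ?nnegrE ?mulr_ge0 ?exprn_ge0.
by rewrite le_eqVlt; apply/orP; left; apply/eqP; ring.
Qed.

Section LevelSet.
Variables (R : rcfType) (F : finFieldType) (e : F -> R[i]).
Hypothesis e0 : e 0 = 1.
Hypothesis eD : forall x y, e (x + y) = e x * e y.
Hypothesis e_nontriv : exists x, e x <> 1.
Hypothesis m1_nonsquare : forall x : F, x ^+ 2 != -1.

Local Notation p := (#|F|%:R : R).
Local Notation V := (F * F)%type.

Section Autocorrelations.
Variables (G : F -> {set V}) (g : F -> V -> R[i]).
Hypothesis g_out : forall t x, x \notin G t -> g t x = 0.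
Hypothesis g_le1 : forall t x, nrm (g t x) <= 1.
Local Notation N a := (#|G a|%:R : R).
Local Notation X := (\sum_a N a).

Let p0 : 0 < p := card_field_gt0 R F.
Let X0 : 0 <= X. Proof. exact: sumr_ge0. Qed.

Definition autocorr_sum : R :=
  \sum_a (N a)^-1 * \sum_(t | t != a) \sum_(w : V | w != 0)
     nrm (autocorr e g a (t - a) w) * slice_hat e G t w.

Lemma autocorr_sum_le_trapezoid : autocorr_sum <= trapezoid_sum e G.
Proof.
apply: ler_sum => a _; rewrite ler_wpM2l ?invr_ge0 ?ler0n //.
apply: ler_sum => t _; apply: ler_sum => w _.
by rewrite ler_wpM2r ?nrm_ge0 // nrm_autocorr_le.
Qed.

(** For each [a], Cauchy-Schwarz in [(t, w)] pairs the rectangle bound of the slice [a] with the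
    Plancherel mass of all slices; a further Cauchy-Schwarz sums the roots of [N a]. Writing
    [p = q^4] makes all exponents integral. *)
Lemma autocorr_sum_le (q : R) : 0 <= q -> q ^+ 4 = p ->
  autocorr_sum <= q ^+ 6 * X + q ^+ 11 * Num.sqrt X.
Proof.
move=> q_ge0 q4; have qgt0 : 0 < q.
  by rewrite lt_def q_ge0 andbT; apply: contraTN p0 => /eqP q0; rewrite -q4 q0 expr0n ltxx.
have sqrtp : Num.sqrt p = q ^+ 2.
  by rewrite -q4 -[4%N]/(2 * 2)%N exprM sqrtr_sqr ger0_norm ?exprn_ge0.
pose b2 := \sum_t \sum_w slice_hat e G t w ^+ 2.
have b2E : b2 = q ^+ 8 * X.
  rewrite /b2 mulr_sumr; apply: eq_bigr => t _.
  by rewrite (slice_hat_l2 e0 eD e_nontriv) -q4 -exprM.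
have step a : (N a)^-1 * \sum_(t | t != a) \sum_(w : V | w != 0)
     nrm (autocorr e g a (t - a) w) * slice_hat e G t w <=
   (Num.sqrt (N a) + q ^+ 3) * (q ^+ 4 * Num.sqrt X).
  have [->|n0] := eqVneq (N a) 0.
    by rewrite invr0 mul0r sqrtr0 add0r !mulr_ge0 ?exprn_ge0 ?sqrtr_ge0.
  have ngt0 : 0 < N a by rewrite lt_def n0 ler0n.
  rewrite mulrC ler_pdivrMr //.
  rewrite pair_big /=; apply: le_trans (cauchy_schwarz _ _ _ _) _.
  rewrite -[X in Num.sqrt X * _](pair_big (fun t => t != a) (fun w : V => w != 0)
     (fun t w => nrm (autocorr e g a (t - a) w) ^+ 2)) /=.
  rewrite mulrAC; apply: ler_pM; rewrite ?sqrtr_ge0 //; last first.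
    have -> : q ^+ 4 * Num.sqrt X = Num.sqrt (q ^+ 8 * X).
      by rewrite sqrtrM ?exprn_ge0 // -[8%N]/(4 * 2)%N exprM sqrtr_sqr ger0_norm ?exprn_ge0.
    rewrite -b2E ler_wsqrtr // /b2 pair_big /= big_mkcond.
    by apply: ler_sum => u _; case: ifP => // _; apply: sqr_ge0.
  have reidx : \sum_(t | t != a) \sum_(w : V | w != 0) nrm (autocorr e g a (t - a) w) ^+ 2 =
      \sum_(tau | tau != 0) \sum_(w : V | w != 0) nrm (autocorr e g a tau w) ^+ 2.
    rewrite (reindex_inj (addIr a)) /=; apply: eq_big => tau.
      by rewrite -subr_eq0 addrK.
    by move=> _; rewrite addrK.
  have le2 : \sum_(t | t != a) \sum_(w : V | w != 0) nrm (autocorr e g a (t - a) w) ^+ 2 <=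
      N a ^+ 3 + (q ^+ 3 * N a) ^+ 2.
    rewrite reidx; apply: le_trans (autocorr_l2_le e0 eD e_nontriv m1_nonsquare g_out g_le1 a) _.
    apply: le_trans (ler_wpM2l _ (corner_le e0 eD e_nontriv m1_nonsquare (G a))) _.
      exact: ler0n.
    rewrite sqrtp -q4 le_eqVlt; apply/orP; left; apply/eqP; field.
    by rewrite gt_eqF.
  apply: le_trans (ler_wsqrtr le2) _.
  apply: le_trans (sqrtrD_le _ _) _; rewrite ?sqr_ge0 ?exprn_ge0 //.
  rewrite sqrtr_sqr ger0_norm ?mulr_ge0 ?exprn_ge0 // mulrDl.
  rewrite lerD2r exprSr sqrtrM ?sqr_ge0 // sqrtr_sqr ger0_norm //.
  by rewrite mulrC.
apply: le_trans (ler_sum _ (fun a _ => step a)) _.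
rewrite -mulr_suml big_split /=.
have q7 : \sum_(a : F) q ^+ 3 = q ^+ 7.
  by rewrite sumr_const -[LHS]mulr_natr -q4 -exprD.
have sqX : Num.sqrt X ^+ 2 = X by rewrite sqr_sqrtr.
have sN : \sum_a Num.sqrt (N a) <= q ^+ 2 * Num.sqrt X.
  rewrite -ler_sqr ?nnegrE ?mulr_ge0 ?exprn_ge0 ?sqrtr_ge0 ?sumr_ge0 //; last first.
    by move=> a _; apply: sqrtr_ge0.
  apply: le_trans (sum_sqr_le_card _ _ _) _.
  rewrite sumr_const exprMn sqX -exprM q4 ler_wpM2l //.
  by apply: ler_sum => a _; rewrite sqr_sqrtr.
have -> : q ^+ 6 * X + q ^+ 11 * Num.sqrt X =
    (q ^+ 2 * Num.sqrt X + q ^+ 7) * (q ^+ 4 * Num.sqrt X).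
  by rewrite -{1}sqX; ring.
by rewrite q7 ler_wpM2r ?lerD2r // mulr_ge0 ?exprn_ge0 ?sqrtr_ge0.
Qed.

End Autocorrelations.

Variables (f : V -> R[i]) (l : R).
Hypothesis f_le : \sum_xi nrm (f xi) ^+ 2 <= p ^+ 2.
Hypothesis l_gt0 : 0 < l.

(** The factor [p ^+ 2] compensates the missing normalization of [ext2]; likewise [f_le] says that
    [f] has normalized norm at most 1. *)
Definition level_slice (t : F) : {set V} := [set x | l * p ^+ 2 < nrm (ext2 e f x t)].

Local Notation G := level_slice.
Local Notation N a := (#|G a|%:R : R).
Local Notation X := (\sum_a N a).

Definition phase (t : F) (x : V) : R[i] :=
  if x \in G t then ext2 e f x t / (nrm (ext2 e f x t))%:C else 0.

Let p0 : 0 < p := card_field_gt0 R F.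
Let X0 : 0 <= X. Proof. exact: sumr_ge0. Qed.

Let nrm_ext_gt0 t x : x \in G t -> 0 < nrm (ext2 e f x t).
Proof. by rewrite inE => /(lt_trans _) -> //; rewrite mulr_gt0 ?exprn_gt0. Qed.

Lemma phase_out t x : x \notin G t -> phase t x = 0.
Proof. by move=> /negbTE xG; rewrite /phase xG. Qed.

Lemma phase_le1 t x : nrm (phase t x) <= 1.
Proof.
rewrite /phase; case: ifP => [xG|_]; last by rewrite Normc.normc0 ler01.
rewrite Normc.normcM Normc.normcV nrm_real ?nrm_ge0 // divff //.
by rewrite gt_eqF ?nrm_ext_gt0.
Qed.

Lemma ext_phase t x :
  ext2 e f x t * conjc (phase t x) = (if x \in G t then nrm (ext2 e f x t) else 0)%:C.
Proof.
rewrite /phase; case: ifP => [xG|_]; last by rewrite conjc0 mulr0.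
set z := ext2 _ _ _ _; have z0 : nrm z != 0 by rewrite gt_eqF ?nrm_ext_gt0.
have zc0 : (nrm z)%:C != 0 by rewrite -(rmorph0 (real_complex R)) (inj_eq (@complexI R)).
have -> : conjc (z / (nrm z)%:C) = conjc z / (nrm z)%:C.
  by rewrite rmorphM; congr (_ * _); rewrite -(fmorphV (real_complex R)) [LHS]conjc_real.
by rewrite mulrA -nrm_sqr rmorphXn /= expr2 mulfK.
Qed.

(** Chebyshev's inequality, with the [L^2] mass of each slice given by [ext2_slice]. *)
Lemma level_parseval : l ^+ 2 * X <= p.
Proof.
have pp (m : nat) : 0 < p ^+ m by rewrite exprn_gt0.
rewrite -(ler_pM2l (pp 4)).
apply: (@le_trans _ _ (\sum_t \sum_x nrm (ext2 e f x t) ^+ 2)); last first.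
  under eq_bigr => t _ do rewrite (ext2_slice e0 eD e_nontriv).
  rewrite sumr_const -[leLHS]mulr_natr.
  have -> : p ^+ 4 * p = p ^+ 2 * p ^+ 2 * p by ring.
  by rewrite ler_pM2r // ler_pM2l.
have -> : p ^+ 4 * (l ^+ 2 * X) = (l * p ^+ 2) ^+ 2 * X by ring.
rewrite mulr_sumr; apply: ler_sum => t _.
rewrite -(sum_indicator R (G t)) mulr_sumr; apply: ler_sum => x _.
case: (boolP (x \in G t)) => [|_]; rewrite ?mulr0 ?sqr_ge0 // mulr1 inE => /ltW h.
by rewrite ler_sqr ?nnegrE ?nrm_ge0 // mulr_ge0 ?exprn_ge0 // ltW.
Qed.

Local Notation W :=
  (\sum_a \sum_(t | t != a) \sum_(x in G t) nrm (evolved e phase a t x)).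

Lemma level_duality : l ^+ 2 * p * X ^+ 2 <= p * X + W.
Proof.
have pp (m : nat) : 0 < p ^+ m by rewrite exprn_gt0.
have hd := duality e0 eD e_nontriv m1_nonsquare phase_out phase_le1 f.
have W0 : 0 <= W.
  by do 3!apply: sumr_ge0 => ? _; apply: nrm_ge0.
have hl : (l * p ^+ 2 * X) ^+ 2 <=
    nrm (\sum_t \sum_x ext2 e f x t * conjc (phase t x)) ^+ 2.
  have lX : 0 <= l * p ^+ 2 * X by rewrite !mulr_ge0 ?exprn_ge0 ?(ltW l_gt0).
  rewrite ler_sqr ?nnegrE ?nrm_ge0 //.
  have -> : \sum_t \sum_x ext2 e f x t * conjc (phase t x) =
      (\sum_t \sum_x (if x \in G t then nrm (ext2 e f x t) else 0))%:C.
    rewrite rmorph_sum; apply: eq_bigr => t _; rewrite rmorph_sum.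
    by apply: eq_bigr => x _; apply: ext_phase.
  rewrite nrm_real; last first.
    apply: sumr_ge0 => t _; apply: sumr_ge0 => x _.
    by case: ifP => // _; apply: nrm_ge0.
  rewrite mulr_sumr; apply: ler_sum => t _.
  rewrite -(sum_indicator R (G t)) mulr_sumr; apply: ler_sum => x _.
  by case: (boolP (x \in G t)) => [|_]; rewrite ?mulr0 // mulr1 inE => /ltW.
have := le_trans hl (le_trans hd (ler_wpM2r _ f_le)).
have -> : p ^+ 2 * (p ^+ 2 * X + p * W) = p ^+ 3 * (p * X + W) by ring.
have -> : (l * p ^+ 2 * X) ^+ 2 = p ^+ 3 * (l ^+ 2 * p * X ^+ 2) by ring.
rewrite ler_pM2l //; apply.
by rewrite addr_ge0 ?mulr_ge0 ?exprn_ge0.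
Qed.

(** Cauchy-Schwarz first in [(t, x)] for fixed [a], then over [a] with weights [Num.sqrt (N a)]. The
    frequency 0 contributes at most [N a * N t] for each pair of slices, and these add up to
    [p * X]. *)
Lemma level_evolved_le : W ^+ 2 <= X ^+ 2 * (p * X + autocorr_sum G phase).
Proof.
pose w a := \sum_(t | t != a) \sum_(x in G t) nrm (evolved e phase a t x).
pose z a := \sum_(t | t != a) \sum_(x in G t) nrm (evolved e phase a t x) ^+ 2.
have wz a : w a ^+ 2 <= X * z a.
  rewrite /w /z !pair_big_dep /=; apply: le_trans (sum_sqr_le_card _ _ _) _.
  apply: ler_wpM2r; first by apply: sumr_ge0 => u _; apply: sqr_ge0.
  rewrite -(pair_big_dep (fun t => t != a) (fun t x => x \in G t) (fun _ _ => 1)) /=.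
  rewrite big_mkcond; apply: ler_sum => t _; rewrite sumr_const.
  by case: ifP.
have w0 a : N a = 0 -> w a = 0.
  move=> /eqP; rewrite pnatr_eq0 cards_eq0 => /eqP Ga.
  apply: big1 => t _; apply: big1 => x _; rewrite /evolved big1 ?Normc.normc0 // => y _.
  by rewrite phase_out ?mul0r // Ga inE.
have hW : W ^+ 2 <= X * \sum_a (N a)^-1 * w a ^+ 2.
  have -> : W = \sum_a Num.sqrt (N a) * (Num.sqrt (N a)^-1 * w a).
    apply: eq_bigr => a _; have [/w0 h|n0] := eqVneq (N a) 0.
      by rewrite -/(w a) h !mulr0.
    by rewrite mulrA -sqrtrM ?ler0n // divff // sqrtr1 mul1r.
  apply: le_trans (cauchy_schwarz_sqr _ _ _ _) _.
  rewrite le_eqVlt; apply/orP; left; apply/eqP; congr (_ * _).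
    by apply: eq_bigr => a _; rewrite sqr_sqrtr.
  by apply: eq_bigr => a _; rewrite exprMn sqr_sqrtr ?invr_ge0.
apply: le_trans hW _; rewrite expr2 -mulrA ler_wpM2l //.
apply: (@le_trans _ _ (X * \sum_a (N a)^-1 * z a)).
  rewrite mulr_sumr; apply: ler_sum => a _.
  by rewrite [leRHS]mulrCA ler_wpM2l ?invr_ge0.
rewrite ler_wpM2l //.
have -> : p * X = \sum_(a : F) X by rewrite sumr_const -[RHS]mulr_natr mulrC.
rewrite -big_split /=; apply: ler_sum => a _.
have [->|n0] := eqVneq (N a) 0; first by rewrite invr0 !mul0r addr0.
have -> : X = (N a)^-1 * (N a * X) by field.
rewrite -mulrDr ler_wpM2l ?invr_ge0 //.
have -> : \sum_i N i = \sum_t slice_hat e G t 0.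
  by apply: eq_bigr => t _; rewrite slice_hat0.
apply: (@le_trans _ _ (\sum_(t | t != a) (N a * slice_hat e G t 0 +
    \sum_(w : V | w != 0) nrm (autocorr e phase a (t - a) w) * slice_hat e G t w))).
  apply: ler_sum => t ta.
  apply: le_trans (evolved_l2_le e0 eD m1_nonsquare G phase ta) _.
  rewrite (bigD1 (0 : V)) //= lerD2r ler_wpM2r ?nrm_ge0 //.
  apply: le_trans (nrm_autocorr_le e0 eD phase_out phase_le1 _ _ _) _.
  by rewrite /scale2 /= !mulr0 overlap0.
rewrite big_split /= lerD2r mulr_sumr big_mkcond; apply: ler_sum => t _.
by case: ifP => // _; rewrite mulr_ge0 ?nrm_ge0.
Qed.

Lemma level_direction_mass_le w : w != 0 ->
  direction_mass e G w <= (2 * Num.sqrt p / l ^+ 2) ^+ 2.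
Proof.
move=> w0; pose L := (l * p ^+ 2) ^+ 2.
have L0 : 0 < L by rewrite exprn_gt0 // mulr_gt0 ?exprn_gt0.
have hL t x : x \in G t -> L <= nrm (ext2 e f x t) ^+ 2.
  rewrite inE => /ltW h; rewrite ler_sqr ?nnegrE ?nrm_ge0 //.
  by rewrite mulr_ge0 ?exprn_ge0 // ltW.
have M0 : 0 <= \sum_xi nrm (f xi) ^+ 2 by apply: sumr_ge0 => xi _; apply: sqr_ge0.
rewrite -(ler_pM2l (exprn_gt0 2 L0)).
apply: (@le_trans _ _ (2 * p ^+ 5 * (\sum_xi nrm (f xi) ^+ 2) ^+ 2)).
  apply: le_trans (line_hat_le e0 eD e_nontriv m1_nonsquare (ltW L0) hL w0).
  rewrite ler_wpM2l ?sqr_ge0 //; apply: ler_sum => t _.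
  rewrite big_mkcond; apply: ler_sum => k _; case: ifP => // _; apply: sqr_ge0.
(* This is [4 p^9], against the [2 p^9] required; the slack keeps a root of 2 out of [beta]. *)
have -> : L ^+ 2 * (2 * Num.sqrt p / l ^+ 2) ^+ 2 = 4 * p ^+ 8 * Num.sqrt p ^+ 2.
  by rewrite /L; field; rewrite gt_eqF.
rewrite sqr_sqrtr ?ler0n //.
apply: (@le_trans _ _ (2 * p ^+ 5 * (p ^+ 2) ^+ 2)).
  by rewrite ler_wpM2l ?mulr_ge0 ?exprn_ge0 // ler_sqr ?nnegrE ?exprn_ge0.
have : 0 <= p ^+ 9 by rewrite exprn_ge0.
have -> : 2 * p ^+ 5 * (p ^+ 2) ^+ 2 = 2 * p ^+ 9 by ring.
have -> : 4 * p ^+ 8 * p = 4 * p ^+ 9 by ring.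
by lra.
Qed.

Lemma level_set_le : l <= 1 -> l ^+ 24 * X ^+ 7 <= 2 ^+ 22.
Proof.
move=> l1.
(* [S] omits the term [q^6 X], that is [p^(3/2) X], which the bounds [T1], [T2] and [T3] share. *)
pose q := Num.sqrt (Num.sqrt p); pose h := Num.sqrt X; pose S := autocorr_sum G phase - q ^+ 6 * X.
have q_ge0 : 0 <= q by apply: sqrtr_ge0.
have h0 : 0 <= h by apply: sqrtr_ge0.
have q2 : q ^+ 2 = Num.sqrt p by rewrite sqr_sqrtr ?sqrtr_ge0.
have q4 : q ^+ 4 = p by rewrite -[4%N]/(2 * 2)%N exprM q2 sqr_sqrtr ?ler0n.
have h2 : h ^+ 2 = X by rewrite sqr_sqrtr.
have q1 : 1 <= q.
  rewrite -sqrtr1 ler_wsqrtr // -[X in X <= _]sqrtr1 ler_wsqrtr //.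
  exact: ltW (card_field_gt1 R F).
have l20 : 0 < l ^+ 2 by rewrite exprn_gt0.
have -> : X ^+ 7 = h ^+ 14 by rewrite -h2 -exprM.
pose beta := 2 * Num.sqrt p / l ^+ 2.
have beta0 : 0 <= beta by rewrite divr_ge0 ?mulr_ge0 ?sqrtr_ge0 ?exprn_ge0 ?(ltW l_gt0).
have lb : l ^+ 2 * beta = 2 * q ^+ 2 by rewrite /beta q2; field; rewrite gt_eqF.
have T1 := le_trans (autocorr_sum_le_trapezoid phase_out phase_le1)
  (trapezoid_sum_le1 e0 eD e_nontriv m1_nonsquare beta0 level_direction_mass_le).
have T2 := le_trans (autocorr_sum_le_trapezoid phase_out phase_le1)
  (trapezoid_sum_le2 e0 eD e_nontriv m1_nonsquare beta0 level_direction_mass_le).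
have T3 := autocorr_sum_le phase_out phase_le1 q_ge0 q4.
have qp6 : p * Num.sqrt p = q ^+ 6 by rewrite -q2 -[X in X * _]q4 -exprD.
rewrite qp6 in T1 T2.
apply: (@level_set_arith _ q h l S) => //.
- by rewrite h2 q4 level_parseval.
(* When [l^2 X > 2], the diagonal term [p X] of [level_duality] is absorbed by half of the left
   side. *)
- have [hs|hb] := lerP (l ^+ 2 * h ^+ 2) 2; [by left | right].
  have hd := level_duality; have he := level_evolved_le.
  set w := W in hd he.
  have Xp : 0 < X.
    rewrite lt_def X0 andbT; apply: contraTN hb => /eqP Xz.
    by rewrite h2 Xz mulr0 -leNgt ler0n.
  have hw : l ^+ 2 * p * X ^+ 2 / 2 <= w.
    have : p * X <= l ^+ 2 * p * X ^+ 2 / 2.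
      have -> : l ^+ 2 * p * X ^+ 2 / 2 = p * X * (l ^+ 2 * X / 2) by ring.
      rewrite ler_peMr ?mulr_ge0 ?ler0n // ler_pdivlMr // mul1r -h2.
      exact: ltW.
    by move: hd; lra.
  have hw2 : (l ^+ 2 * p * X ^+ 2 / 2) ^+ 2 <= X ^+ 2 * (p * X + autocorr_sum G phase).
    apply: le_trans he; rewrite ler_sqr ?nnegrE //.
      by rewrite divr_ge0 ?mulr_ge0 ?exprn_ge0 ?(ltW l_gt0).
    by do 3!apply: sumr_ge0 => ? _; apply: nrm_ge0.
  have pq : p * X <= q ^+ 6 * X.
    by rewrite ler_wpM2r // -q4 ler_weXn2l.
  rewrite -(ler_pM2l (exprn_gt0 2 Xp)) h2.
  have -> : X ^+ 2 * (l ^+ 4 * q ^+ 8 * h ^+ 4) = 4 * (l ^+ 2 * p * X ^+ 2 / 2) ^+ 2.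
    by rewrite -h2 -q4; field.
  have -> : X ^+ 2 * (4 * (2 * q ^+ 6 * X + S)) =
      4 * (X ^+ 2 * (q ^+ 6 * X + autocorr_sum G phase)) by rewrite /S; ring.
  rewrite ler_pM2l //; apply: le_trans hw2 _.
  by rewrite ler_wpM2l ?exprn_ge0 // lerD2r.
- rewrite h2 -lb -[leRHS]mulrA ler_pM2l // /S; move: T1; lra.
- have -> : 2 * q ^+ 10 + 2 * q ^+ 2 * h ^+ 3 * l ^+ 2 =
     l ^+ 2 * (beta * p ^+ 2 + X * (2 * q ^+ 2 * h)).
    transitivity ((l ^+ 2 * beta) * p ^+ 2 + l ^+ 2 * (X * (2 * q ^+ 2 * h))); last by ring.
    by rewrite lb -h2 -q4; ring.
  rewrite ler_pM2l // /S.
  have : Num.sqrt (2 * p * X) <= 2 * q ^+ 2 * h.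
    have -> : 2 * q ^+ 2 * h = Num.sqrt (4 * p * X).
      rewrite sqrtrM ?mulr_ge0 // sqrtrM // -q2 /h; congr (_ * _ * _).
      by rewrite -[4]/((2 * 2)%:R) natrM -expr2 sqrtr_sqr ger0_norm.
    by rewrite ler_wsqrtr // ler_wpM2r // ler_wpM2r // ler_nat.
  move/(ler_wpM2l X0); move: T2; lra.
- by rewrite /S; move: T3; rewrite -/h; lra.
Qed.

End LevelSet.

(** * From level sets to the theorem *)

Lemma dyadic_level (R : realType) (v : R) : 0 < v -> v <= 1 ->
  exists j, 2^-1 ^+ j.+1 < v <= 2^-1 ^+ j.
Proof.
move=> v0 v1.
have ex : exists j, 2^-1 ^+ j.+1 < v.
  have vi : v^-1 < 2 ^+ (Num.bound v^-1) by apply: upper_nthrootP.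
  exists (Num.bound v^-1); rewrite exprVn invf_plt ?posrE ?exprn_gt0 //.
  by apply: lt_le_trans vi _; rewrite ler_eXn2l ?ltr1n.
case: (ex_minnP ex) => -[|j] hj hmin; first by exists 0%N; rewrite hj expr0.
by exists j.+1; rewrite hj leNgt; apply/negP => /hmin; rewrite ltnn.
Qed.

Lemma geometric_sum_le (R : realFieldType) (x : R) n : 0 <= x -> x < 1 ->
  \sum_(j < n) x ^+ j <= (1 - x)^-1.
Proof.
move=> x0 x1; have d0 : 0 < 1 - x by rewrite subr_gt0.
rewrite -[leRHS]mul1r ler_pdivlMr // mulrC.
have -> : (1 - x) * \sum_(j < n) x ^+ j = 1 - x ^+ n.
  by rewrite -[RHS]opprB subrX1 -mulNr opprB.
by rewrite gerBl exprn_ge0.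
Qed.

(* The exponent [24 / 7] is what [level_set_le] gives for the decay of the
   distribution function. *)
Lemma layer_cake (R : realType) (r : R) : 24 / 7 < r ->
  exists C : R, forall (T : finType) (v : T -> R),
    (forall x, 0 <= v x <= 1) ->
    (forall l, 0 < l -> l <= 1 -> l ^+ 24 * #|[set x | l < v x]|%:R ^+ 7 <= 2 ^+ 22) ->
    \sum_x v x `^ r <= C.
Proof.
(* Per dyadic level, the bound on the size of the level set grows by [a] and the integrand shrinks
   by [b]; [a * b < 1] is the condition on [r]. *)
move=> hr; pose a : R := 2 `^ (24 / 7); pose b : R := 2 `^ (- r).
have a0 : 0 < a by rewrite powR_gt0.
have b0 : 0 < b by rewrite powR_gt0.
have r0 : 0 < r by apply: lt_trans hr; rewrite divr_gt0.
have a7 : a ^+ 7 = 2 ^+ 24.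
  by rewrite -(powR_mulrn 7) ?(ltW a0) // -powRrM divfK ?pnatr_eq0 // powR_mulrn.
have ab1 : a * b < 1.
  rewrite /a /b -powRD; last by rewrite pnatr_eq0 implybT.
  rewrite -[_ - r]opprB powRN invf_lt1 ?powR_gt0 //.
  have y0 : 0 < r - 24 / 7 by rewrite subr_gt0.
  have : 1 `^ (r - 24 / 7) < 2 `^ (r - 24 / 7).
    by apply: gt0_ltr_powR; rewrite ?nnegrE ?ltr1n.
  by rewrite powR1.
have bE j : (2^-1 ^+ j) `^ r = b ^+ j.
  have c0 : 0 <= 2^-1 :> R by rewrite invr_ge0.
  rewrite -(powR_mulrn _ c0) -powRrM mulrC powRrM powR_mulrn ?powR_ge0 //.
  by rewrite -powR_inv1 // -powRrM mulN1r.
(* The factor 16 suffices because [2^22 <= 16^7]; the extra [a] comes from bounding the values at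
   level [j] by the set of level [j + 1]. *)
exists (16 * a * (1 - a * b)^-1) => T v v01 hlev.
have hX j : #|[set x | 2^-1 ^+ j.+1 < v x]|%:R <= 16 * a ^+ j.+1.
  set X := _%:R; have hl := hlev (2^-1 ^+ j.+1).
  have c0 : 0 < 2^-1 ^+ j.+1 :> R by rewrite exprn_gt0 // invr_gt0.
  have {}hl := hl c0; rewrite exprn_ile1 ?invr_ge0 ?invf_le1 ?ler1n // in hl.
  have {}hl := hl isT; rewrite -/X in hl.
  rewrite -(@ler_pXn2r _ 7) ?nnegrE ?mulr_ge0 ?exprn_ge0 ?(ltW a0) ?ler0n //.
  rewrite exprMn -exprM mulnC exprM a7 -exprM.
  have t0 : 0 < 2^-1 ^+ j.+1 ^+ 24 :> R by rewrite exprn_gt0.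
  rewrite -(ler_pM2l t0); apply: le_trans hl _.
  rewrite -exprM exprVn mulnC mulrCA mulVf ?expf_neq0 ?pnatr_eq0 // mulr1.
  have -> : 16 = 2 ^+ 4 :> R by ring.
  by rewrite -exprM ler_eXn2l ?ltr1n.
have lev x : exists j, (0 < v x) ==> (2^-1 ^+ j.+1 < v x <= 2^-1 ^+ j).
  have [vx|_] := boolP (0 < v x); last by exists 0%N.
  have /andP[_ v1] := v01 x; have [j hj] := dyadic_level vx v1.
  by exists j.
(* Finiteness of [T] gives a last level [n], which depends on [v] but disappears from the geometric
   bound. *)
pose J x := xchoose (lev x); pose n := (\max_x J x).+1.
have Jn x : (J x < n)%N by rewrite ltnS; apply: leq_bigmax.
have step : \sum_x v x `^ r <= \sum_x \sum_(j < n) b ^+ j * (2^-1 ^+ j.+1 < v x)%R%:R.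
  apply: ler_sum => x _; have /andP[vx0 _] := v01 x.
  have term0 (j : 'I_n) : 0 <= b ^+ j * (2^-1 ^+ j.+1 < v x)%R%:R.
    by rewrite mulr_ge0 ?exprn_ge0 ?(ltW b0) ?ler0n.
  have [vx|vx] := boolP (0 < v x); last first.
    have -> : v x = 0 by apply/eqP; rewrite eq_le vx0 andbT leNgt.
    rewrite powR0 ?gt_eqF //; apply: sumr_ge0 => j _.
    by rewrite mulr_ge0 ?exprn_ge0 ?(ltW b0) ?ler0n.
  have /andP[h1 h2] := implyP (xchooseP (lev x)) vx.
  rewrite (bigD1 (Ordinal (Jn x))) //= h1 mulr1 -[leLHS]addr0; apply: lerD.
    by rewrite -bE; apply: ge0_ler_powR h2; rewrite ?nnegrE ?exprn_ge0 ?invr_ge0 ?ltW.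
  by apply: sumr_ge0 => j _; apply: term0.
apply: le_trans step _; rewrite exchange_big /=.
apply: (@le_trans _ _ (\sum_(j < n) 16 * a * (a * b) ^+ j)).
  apply: ler_sum => j _; rewrite -mulr_sumr.
  have -> : \sum_x (2^-1 ^+ j.+1 < v x)%R%:R = #|[set x | 2^-1 ^+ j.+1 < v x]|%:R :> R.
    by rewrite -natr_sum -sum1dep_card [in RHS]big_mkcond.
  apply: le_trans (ler_wpM2l _ (hX j)) _; first by rewrite exprn_ge0 ?ltW.
  by rewrite le_eqVlt; apply/orP; left; apply/eqP; rewrite exprMn exprS; ring.
rewrite -mulr_sumr ler_wpM2l ?mulr_ge0 ?(ltW a0) //.
by apply: geometric_sum_le => //; rewrite mulr_ge0 ?ltW.
Qed.

(** * Coordinates on the paraboloid and normalization *)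

Section Transfer.
Variables (R : realType) (p : nat) (e : 'F_p -> R[i]).
Hypothesis p_prime : prime p.
Hypothesis m1_nonsquare : ~ (exists x : 'F_p, x ^+ 2 = - 1).
Hypothesis e_char : additive_character e.
Hypothesis e_nontriv : nontrivial e.

Local Notation F := 'F_p.
Local Notation V := (F * F)%type.

Let m1_neq (x : F) : x ^+ 2 != -1.
Proof. by apply/eqP => h; apply: m1_nonsquare; exists x. Qed.

Definition row2 (u : V) : 'rV[F]_2 := \row_(j < 2) (if j == ord0 then u.1 else u.2).

Lemma dot_row2 u v : dot (row2 u) (row2 v) = dot2 u v.
Proof. by rewrite /dot !big_ord_recl big_ord0 !mxE /= addr0. Qed.

Lemma paraboloid3_row2 u :
  row_mx (row2 u) (const_mx (dot (row2 u) (row2 u)) : 'rV_1) \in paraboloid3 p.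
Proof. by apply/imsetP; exists (row2 u). Qed.

Definition point (u : V) : P3 p :=
  exist (fun xi : 'rV[F]_3 => is_true (xi \in paraboloid3 p)) _ (paraboloid3_row2 u).

Lemma val_point u : val (point u) =
  row_mx (row2 u) (const_mx (dot (row2 u) (row2 u)) : 'rV_1).
Proof. by []. Qed.

Definition coord (x : 'rV[F]_3) : V * F :=
  ((x ord0 (lshift 1 (ord0 : 'I_2)), x ord0 (lshift 1 (ord_max : 'I_2))),
   x ord0 (rshift 2 (ord0 : 'I_1))).

Lemma coord_inj : injective coord.
Proof.
move=> x y [h0 h1 h2]; apply/rowP => i.
rewrite -(splitK (i : 'I_(2 + 1))); case: (split _) => j /=.
  by case: j => -[|[|//]] hj; [move: h0 | move: h1]; congr (_ = _); congr (_ _ _); apply: val_inj.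
by rewrite ord1.
Qed.

Lemma coord_row_mx (x : 'rV[F]_2) (y : 'rV[F]_1) :
  coord (row_mx x y) = ((x ord0 ord0, x ord0 ord_max), y ord0 ord0).
Proof.
rewrite /coord; congr ((_, _), _); [exact: row_mxEl | exact: row_mxEl | exact: row_mxEr].
Qed.

Lemma dot_coord (x y : 'rV[F]_3) :
  dot x y = dot2 (coord x).1 (coord y).1 + (coord x).2 * (coord y).2.
Proof.
rewrite /dot (@big_split_ord _ _ _ 2 1) /= big_ord1; congr (_ + _).
rewrite !big_ord_recl big_ord0 addr0 /dot2 /=.
by congr (_ * _ + _ * _); congr (_ _ _); apply: val_inj.
Qed.

Lemma coord_point u : coord (val (point u)) = (u, dot2 u u).
Proof.
by rewrite val_point coord_row_mx !mxE -/(dot (row2 u) (row2 u)) dot_row2; case: u.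
Qed.

Lemma dot_point (x : 'rV[F]_3) u :
  dot x (val (point u)) = dot2 (coord x).1 u + (coord x).2 * dot2 u u.
Proof. by rewrite dot_coord coord_point. Qed.

Lemma point_bij : bijective point.
Proof.
exists (fun xi => (coord (val xi)).1) => [u|xi]; first by rewrite coord_point.
apply: val_inj; have /imsetP[x _ hx] := valP xi; rewrite hx coord_row_mx val_point /=.
suff -> : row2 (x ord0 ord0, x ord0 ord_max) = x by [].
by apply/rowP => j; rewrite mxE; case: j => -[|[|//]] hj /=; congr (x _ _); apply: val_inj.
Qed.

Lemma sum_point (T : nmodType) (h : P3 p -> T) :
  \sum_(xi : P3 p) h xi = \sum_u h (point u).
Proof. by rewrite (reindex point) //; apply: onW_bij; apply: point_bij. Qed.

Lemma extensionE (f : P3 p -> R[i]) x :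
  extension e f x = p%:R ^- 2 * ext2 e (f \o point) (coord x).1 (coord x).2.
Proof.
rewrite /extension sum_point; congr (_ * _); apply: eq_bigr => u _.
by rewrite dot_point.
Qed.

(** By homogeneity [f] is divided by its norm [A]; the level set estimate then applies to [v], the
    modulus of the normalized extension. *)
Lemma norm_Lr_le (r C : R) : 0 < r ->
    (forall (T : finType) (v : T -> R),
      (forall x, 0 <= v x <= 1) ->
      (forall l, 0 < l -> l <= 1 -> l ^+ 24 * #|[set x | l < v x]|%:R ^+ 7 <= 2 ^+ 22) ->
      \sum_x v x `^ r <= C) ->
  forall f : P3 p -> R[i], norm_Lr_F3 r (extension e f) <= C `^ r^-1 * norm_L2_P3 f.
Proof.
move=> r0 hC f; have [e0 eD] := e_char.
have cF : #|F| = p by rewrite card_Fp.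
have pgt0 : 0 < p%:R :> R by rewrite ltr0n prime_gt0.
have p2 : 0 < p%:R ^+ 2 :> R by rewrite exprn_gt0.
have nrmp2 : nrm (p%:R ^- 2 : R[i]) = p%:R ^- 2.
  rewrite Normc.normcV -[p%:R ^+ 2]natrX nrm_nat natrX //.
set A := norm_L2_P3 f.
have SA : \sum_(xi : P3 p) nrm (f xi) ^+ 2 = A ^+ 2 * p%:R ^+ 2.
  rewrite sqr_sqrtr; last first.
    by rewrite mulr_ge0 ?invr_ge0 ?sumr_ge0 // ?ltW // => xi _; apply: sqr_ge0.
  by rewrite mulrAC mulVf ?mul1r // gt_eqF.
have A0 : 0 <= A by apply: sqrtr_ge0.
have [Az|An] := eqVneq A 0.
  have f0 xi : f xi = 0.
    apply: Normc.eq0_normc; apply/eqP; rewrite -sqrf_eq0.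
    move: SA; rewrite Az expr0n mul0r => /eqP; rewrite psumr_eq0 => [/allP/(_ xi)|? _]; last exact: sqr_ge0.
    by rewrite mem_index_enum => /(_ isT).
  have ez x : extension e f x = 0.
    by rewrite /extension big1 ?mulr0 // => xi _; rewrite f0 mul0r.
  rewrite Az mulr0 /norm_Lr_F3 big1 ?powR0 ?invr_eq0 ?gt_eqF // => x _.
  by rewrite ez Normc.normc0 powR0 ?gt_eqF.
have Agt0 : 0 < A by rewrite lt_def An.
pose g u : R[i] := (A^-1)%:C * f (point u).
have Sg : \sum_u nrm (g u) ^+ 2 = #|F|%:R ^+ 2.
  under eq_bigr => u _ do rewrite Normc.normcM nrm_real ?invr_ge0 // exprMn.
  rewrite -mulr_sumr -(sum_point (fun xi => nrm (f xi) ^+ 2)) SA cF.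
  by rewrite exprVn mulKf // expf_neq0.
pose v x : R := p%:R ^- 2 * nrm (ext2 e g (coord x).1 (coord x).2).
have extv x : nrm (extension e f x) = A * v x.
  have -> : extension e f x = A%:C * (p%:R ^- 2 * ext2 e g (coord x).1 (coord x).2).
    rewrite extensionE mulrCA; congr (_ * _); rewrite /ext2 mulr_sumr.
    apply: eq_bigr => u _; rewrite /g !mulrA -rmorphM /= divff // mul1r //.
  by rewrite !Normc.normcM nrmp2 nrm_real.
(* Triangle inequality and Cauchy-Schwarz over the [p^2] points of the paraboloid. *)
have vle x : 0 <= v x <= 1.
  rewrite /v mulr_ge0 ?invr_ge0 ?nrm_ge0 ?(ltW p2) //= mulrC ler_pdivrMr // mul1r.
  have h1 : nrm (ext2 e g (coord x).1 (coord x).2) <= \sum_u nrm (g u).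
    apply: le_trans (nrm_sum _ _ _) _; apply: ler_sum => u _.
    by rewrite Normc.normcM (char_nrm e0 eD) mulr1.
  apply: le_trans h1 _.
  rewrite -ler_sqr ?nnegrE ?sumr_ge0 ?(ltW p2) //; last by move=> u _; apply: nrm_ge0.
  apply: le_trans (sum_sqr_le_card _ _ _) _.
  by rewrite Sg sumr_const card_prod cF natrM -!expr2.
have lev l : 0 < l -> l <= 1 -> l ^+ 24 * #|[set x | l < v x]|%:R ^+ 7 <= 2 ^+ 22.
  move=> l0 l1; have Sg' : \sum_u nrm (g u) ^+ 2 <= #|F|%:R ^+ 2 by rewrite Sg.
  apply: le_trans (level_set_le e0 eD e_nontriv m1_neq Sg' l0 l1).
  rewrite ler_wpM2l ?exprn_ge0 ?(ltW l0) // lerXn2r ?nnegrE ?sumr_ge0 //.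
  have -> : \sum_a #|level_slice e g l a|%:R =
      \sum_(u : V * F | l * #|F|%:R ^+ 2 < nrm (ext2 e g u.1 u.2)) 1 :> R.
    under eq_bigr => t _ do rewrite -sum1_card natr_sum big_mkcond.
    rewrite exchange_big pair_big [RHS]big_mkcond /=.
    by apply: eq_bigr => u _; rewrite inE.
  rewrite -sum1_card natr_sum.
  apply: (sum_inj_le (phi := coord) (h := fun=> 1)) => [x y _ _|x|//].
    exact: coord_inj.
  by rewrite inE /v cF mulrC ltr_pdivlMr.
have hv := hC _ v vle lev.
have -> : norm_Lr_F3 r (extension e f) = (A `^ r * \sum_x v x `^ r) `^ r^-1.
  rewrite /norm_Lr_F3 mulr_sumr; congr (_ `^ _); apply: eq_bigr => x _.
  by rewrite extv powRM //; case/andP: (vle x).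
have S0 : 0 <= \sum_x v x `^ r by apply: sumr_ge0 => x _; apply: powR_ge0.
rewrite powRM ?powR_ge0 // -powRrM divff ?gt_eqF // powRr1 // mulrC.
rewrite ler_wpM2r //; apply: ge0_ler_powR => //; rewrite ?nnegrE //.
  by rewrite invr_ge0 ltW.
exact: le_trans S0 hv.
Qed.

End Transfer.

Theorem theorem1p1 (R : realType) (r : R) (hr : 176%:R / 51%:R < r) :
  exists C : R, forall (p : nat) (e : 'F_p -> R[i]),
    prime p ->
    ~ (exists x : 'F_p, x ^+ 2 = - 1) ->
    additive_character e ->
    nontrivial e ->
    forall f : P3 p -> R[i],
      norm_Lr_F3 r (extension e f) <= C * norm_L2_P3 f.
Proof.
have hr' : 24 / 7 < r by apply: lt_trans hr; lra.
have r0 : 0 < r by apply: lt_trans hr'; lra.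
have [C hC] := layer_cake hr'.
by exists (C `^ r^-1) => p e pp m1 ec en f; apply: norm_Lr_le.
Qed.
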